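(* The following properties hold with probability 1. (1) Under any sampling rule satisfying $T_{n,i}/n\to w_i^*$ for each $i\in A$, $$\lim_{n\to\infty}-\frac1n\log(1-\alpha_{n,1})=\Gamma^*.$$ Under any sampling rule, $$\limsup_{n\to\infty}-\frac1n\log(1-\alpha_{n,1})\le\Gamma^*.$$ (2) Let $\beta\in(0,1)$. Under any sampling rule satisfying $T_{n,i}/n\to w_i^\beta$ for each $i\in A$, $$\lim_{n\to\infty}-\frac1n\log(1-\alpha_{n,1})=\Gamma_\beta^*.$$ Under any sampling rule satisfying $T_{n,1}/n\to\beta$, $$\limsup_{n\to\infty}-\frac1n\log(1-\alpha_{n,1})\le\Gamma_\beta^*.$$
   Context: Setting: $k\ge 2$, $A=\{1,\dots,k\}$ is the set of arms, $\sigma>0$ is known, and $\mu_1>\mu_2>\dots>\mu_k$ are fixed real numbers (the true means). Rewards $Y_{n,i}\sim N(\mu_i,\sigma^2)$ are independent over $n\in\mathbb{N}=\{1,2,\dots\}$ and $i\in A$. A sampling (allocation) rule selects at each time $n$ an arm $I_n$ as a function of $(I_1,Y_{1,I_1},\dots,I_{n-1},Y_{n-1,I_{n-1}})$ and possibly independent randomization; then $Y_{n,I_n}$ is observed. $T_{n,i}=\sum_{\ell=1}^{n-1}\mathbf{1}\{I_\ell=i\}$. Convergence of sampling proportions is understood with probability 1. Posterior: starting from a prior $N(\mu_{1,i},\sigma_{1,i}^2)$ with $\mu_{1,i}\in\mathbb{R}$, $\sigma_{1,i}\in(0,\infty)$, independent across arms, the parameters are updated by: if $I_n=i$, then $\mu_{n+1,i}=(\sigma_{n,i}^{-2}\mu_{n,i}+\sigma^{-2}Y_{n,i})/(\sigma_{n,i}^{-2}+\sigma^{-2})$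 and $\sigma_{n+1,i}^2=1/(\sigma_{n,i}^{-2}+\sigma^{-2})$; if $I_n\neq i$, both are unchanged. The posterior is $\Pi_n=N(\mu_{n,1},\sigma_{n,1}^2)\otimes\dots\otimes N(\mu_{n,k},\sigma_{n,k}^2)$, and $$\alpha_{n,i}=\mathbb{P}_{\theta\sim\Pi_n}\Big(\theta_i>\max_{j\ne i}\theta_j\Big)$$ where $\theta=(\theta_1,\dots,\theta_k)$; this is a random quantity depending on the history. Proportions and complexity: for $\beta\in(0,1)$, $w_1^\beta=\beta$ and $(w_2^\beta,\dots,w_k^\beta)$ is the unique vector of positive numbers with $\sum_{i=2}^kw_i^\beta=1-\beta$ for which $\frac{(\mu_i-\mu_1)^2}{1/w_i^\beta+1/\beta}$ takes the same value for all $i=2,\dots,k$. Set $$\Gamma_\beta^*=\frac{(\mu_i-\mu_1)^2}{2\sigma^2(1/w_i^\beta+1/\beta)}\quad(\text{any } i\in\{2,\dots,k\}),$$ $\Gamma^*=\max_{\beta\in(0,1)}\Gamma_\beta^*$, $\beta^*=\arg\max_{\beta\in(0,1)}\Gamma_\beta^*$, and $w^*=w^{\beta^*}$. *)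

(* Defs.v *)
(* There are k = K.+2 >= 2 arms, indexed by 'I_K.+2: arm 1 is ord0,
   arm 2 is lift ord0 ord0.  Rounds are counted from 0, so round n is
   time n + 1 and n.+1%:R is the normalization. *)
From HB Require Import structures.
From mathcomp Require Import all_boot all_order all_algebra.
From mathcomp Require Import finmap.
From mathcomp Require Import all_classical all_reals all_analysis.
Import Order.TTheory GRing.Theory Num.Theory.
Import numFieldNormedType.Exports.

Set Implicit Arguments.
Unset Strict Implicit.
Unset Printing Implicit Defensive.

Local Open Scope classical_set_scope.
Local Open Scope ring_scope.

Section independence.
Context d (T : measurableType d) (R : realType) (P : probability T R).

Definition sigma_rv d' (S : measurableType d') (X : T -> S) : set (set T) :=
  preimage_set_system setT X measurable.

Definition mutually_independent (I : choiceType) (F : I -> set (set T)) :=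
  forall (J : {fset I}) (E : I -> set T),
    (forall i, i \in J -> F i (E i)) ->
    P (\bigcap_(i in [set` J]) E i) = (\prod_(i <- J) P (E i))%E.

Definition independent (F G : set (set T)) :=
  forall A B, F A -> G B -> P (A `&` B) = (P A * P B)%E.

End independence.

Section tuple_product.
Context d (T : measurableType d) (R : realType).

Definition consT n (x : T * n.-tuple T) : n.+1.-tuple T :=
  [the n.+1.-tuple T of x.1 :: x.2].

Lemma measurable_consT n : measurable_fun setT (@consT n).
Proof. by apply: measurable_cons. Qed.

HB.instance Definition _ n :=
  isMeasurableFun.Build _ _ _ _ (@consT n) (@measurable_consT n).

(* Product probability Q 0 \x Q 1 \x ... on tuples; the library only has
   binary products. *)
Fixpoint tuple_prob n : ('I_n -> probability T R) -> probability (n.-tuple T) R :=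
  match n with
  | 0 => fun=> \d_([tuple])
  | m.+1 => fun Q =>
      distribution (Q ord0 \x @tuple_prob m (fun i => Q (lift ord0 i)))%E (@consT m)
  end.

End tuple_product.

Section bandit.
Context (R : realType) (K : nat) d (Omega : measurableType d)
  (P : probability Omega R).
Local Notation arm := 'I_K.+2.
Implicit Types (Y : nat -> arm -> {RV P >-> R}) (I : nat -> Omega -> arm).

(* All rewards are mutually independent, and Y n i ~ N(mu i, sigma^2). *)
Definition gaussian_rewards (mu : arm -> R) (sigma : R) Y :=
  mutually_independent P (fun ni : nat * arm => sigma_rv (Y ni.1 ni.2)) /\
  forall n i (A : set R), measurable A ->
    distribution P (Y n i) A = normal_prob (mu i) sigma A.

(* I n is a measurable function of the arms and rewards observed in rounds
   0, ..., n - 1 and of a randomization seed U independent of the rewards; U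
   may be a whole sequence of seeds.  Since the arms are finitely many, joint
   measurability is required for each fixed sequence a of past arms. *)
Definition sampling_rule Y I :=
  exists dU (S : measurableType dU) (U : {RV P >-> S})
    (rule : forall n, n.-tuple arm -> S * n.-tuple R -> arm),
    [/\ independent P (sigma_rv U)
          <<s \bigcup_(ni : nat * arm) sigma_rv (Y ni.1 ni.2) >>,
        forall n (a : n.-tuple arm) i, measurable [set x | rule n a x = i] &
        forall n w, I n w = rule n [tuple I l w | l < n]
                               (U w, [tuple (Y l (I l w) : Omega -> R) w | l < n])].

Definition pulls I n (i : arm) (w : Omega) : nat := (\sum_(l < n) (I l w == i))%N.

Definition proportions_cvg I (i : arm) (p : R) :=
  {ae P, forall w, (pulls I n i w)%:R / n.+1%:R @[n --> \oo] --> p}.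

(* Posterior mean and variance of arm i after n rounds, from the prior
   N(m0 i, s0 i ^ 2). *)
Fixpoint posterior_mv (sigma : R) (m0 s0 : arm -> R) Y I n (i : arm) (w : Omega)
    : R * R :=
  match n with
  | 0 => (m0 i, s0 i ^+ 2)
  | l.+1 =>
      let: (m, v) := posterior_mv sigma m0 s0 Y I l i w in
      if I l w == i then
        ((v^-1 * m + sigma ^- 2 * Y l i w) / (v^-1 + sigma ^- 2),
         (v^-1 + sigma ^- 2)^-1)
      else (m, v)
  end.

(* normal_prob is parametrized by the standard deviation and typed on
   measurableTypeR R, i.e. R with its Borel sets. *)
Definition posterior sigma m0 s0 Y I n w :
    probability ((K.+2).-tuple (measurableTypeR R)) R :=
  tuple_prob (fun i =>
    let: (m, v) := posterior_mv sigma m0 s0 Y I n i w in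
    normal_prob m (Num.sqrt v)).

Definition alpha sigma m0 s0 Y I n (i : arm) w : R :=
  fine (posterior sigma m0 s0 Y I n w
    [set theta | forall j, j != i -> tnth theta j < tnth theta i]).

Definition rate sigma m0 s0 Y I n w : R :=
  - (n.+1%:R)^-1 * ln (1 - alpha sigma m0 s0 Y I n ord0 w).

End bandit.

Section complexity.
Context (R : realType) (K : nat) (mu : 'I_K.+2 -> R) (sigma : R).

Definition is_weights (b : R) (w : 'I_K.+2 -> R) :=
  [/\ w ord0 = b,
      forall i, i != ord0 -> 0 < w i,
      \sum_(i | i != ord0) w i = 1 - b &
      forall i j, i != ord0 -> j != ord0 ->
        (mu i - mu ord0) ^+ 2 / ((w i)^-1 + b^-1) =
        (mu j - mu ord0) ^+ 2 / ((w j)^-1 + b^-1)].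

(* The choice operator returns its default only where no such vector exists,
   which does not happen for 0 < b < 1; likewise for beta_star below. *)
Definition weights (b : R) : 'I_K.+2 -> R := xget (fun=> 0) (is_weights b).

(* Evaluated at arm 2; is_weights makes the value independent of the arm. *)
Definition Gamma (b : R) : R :=
  let i : 'I_K.+2 := lift ord0 ord0 in
  (mu i - mu ord0) ^+ 2 / (2 * sigma ^+ 2 * ((weights b i)^-1 + b^-1)).

Definition is_argmax_Gamma (b : R) :=
  0 < b < 1 /\ forall b', 0 < b' < 1 -> Gamma b' <= Gamma b.

Definition beta_star : R := xget 0 is_argmax_Gamma.

Definition Gamma_star : R := Gamma beta_star.

Definition weights_star : 'I_K.+2 -> R := weights beta_star.

End complexity.

(* Main.v *)
(* Write [T n i] for the number of pulls of arm [i] before round [n], [S n i]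
   for the sum of the centred rewards observed from it, and [v n i], [m n i] for
   its posterior variance and mean.

   Since arm selection is independent of the current reward,
   [exp (l * S n i - l^2 sigma^2 T n i / 2)] has expectation 1.  Markov's
   inequality with [l] tuned to each possible value of [T n i], followed by
   Borel-Cantelli, gives [S n i ^ 2 = o(n (1 + T n i))] almost surely under any
   sampling rule, that is [(m n i - mu i)^2 / (n v n i) -> 0].  This one
   estimate also covers arms that are pulled rarely or finitely often.

   A Chernoff bound gives
     [1 - alpha <= sum_j exp (- (m 1 - m j)^2 / (2 (v 1 + v j)))]
   (with nearly optimal exponents), and independence of the posterior marginals
   gives [1 - alpha >= P (theta_1 <= x) * P (theta_j >= x)] for all [j] and [x].
   On the exponential scale the latter costs
     [(T 1 (x - mu 1)^2 + T j (x - mu j)^2) / (2 sigma^2)],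
   which is linear in the numbers of pulls.  If [T 1 / n] is close to [b], some
   arm [j] has [T j / n] at most about [w_j^b], and at the optimal [x] for the
   weights [w^b] the cost is at most about [n Gamma_b].  For an arbitrary rule
   this is applied with [b = T 1 / n] at each [n] separately. *)
From HB Require Import structures.
Require Import Defs.
From mathcomp Require Import all_boot all_order all_algebra.
From mathcomp Require Import ring lra finmap.
From mathcomp Require Import all_classical all_reals all_analysis.
From mathcomp Require Import measurable_realfun.
Import Order.TTheory GRing.Theory Num.Theory.
Import numFieldNormedType.Exports.

Set Implicit Arguments.
Unset Strict Implicit.
Unset Printing Implicit Defensive.

Local Open Scope classical_set_scope.
Local Open Scope ring_scope.

(** * Gaussian integrals and tails *)

Section normal.
Context (R : realType).
Implicit Types m s l x a b y : R.
Local Notation leb := (@lebesgue_measure R).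

(** The Radon-Nikodym derivative of [normal_prob] and [normal_pdf] have the same integral over every
    measurable set, hence agree almost everywhere; the rest is change of variables. *)
Lemma ge0_integral_normal_prob m s (f : R -> \bar R) :
  measurable_fun [set: R] f -> (forall x, 0 <= f x)%E ->
  (\int[normal_prob m s]_x f x = \int[leb]_x (f x * (normal_pdf m s x)%:E))%E.
Proof.
move=> mf f0.
have dom := normal_prob_dominates m s.
rewrite -(Radon_Nikodym_SigmaFinite.change_of_variables dom)//.
have intg := Radon_Nikodym_SigmaFinite.f_integrable dom.
apply: ge0_ae_eq_integral => //.
- by apply: emeasurable_funM => //; exact: measurable_int intg.
- apply: emeasurable_funM => //; apply/measurable_EFinP.
  exact: measurable_normal_pdf.
- move=> x _; rewrite mule_ge0//.
  exact: Radon_Nikodym_SigmaFinite.f_ge0.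
- by move=> x _; rewrite mule_ge0// lee_fin normal_pdf_ge0.
- apply: ae_eqe_mul2l; apply: integral_ae_eq => //.
  + by apply/measurable_EFinP; exact: measurable_normal_pdf.
  + by move=> E _ mE; rewrite -Radon_Nikodym_SigmaFinite.f_integral.
Qed.

(** Completing the square: [expR (l * x)] times the density centred at [m] is a constant times the
    density centred at [m + l * s ^+ 2]. *)
Lemma normal_mgf m s l : s != 0 ->
  (\int[normal_prob m s]_x (expR (l * x))%:E =
   (expR (l * m + l ^+ 2 * s ^+ 2 / 2))%:E)%E.
Proof.
move=> s0; rewrite ge0_integral_normal_prob; last 2 first.
- by apply/measurable_EFinP; apply: measurableT_comp.
- by move=> x; rewrite lee_fin expR_ge0.
transitivity (\int[leb]_x ((expR (l * m + l ^+ 2 * s ^+ 2 / 2))%:E *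
   (normal_pdf (m + l * s ^+ 2) s x)%:E))%E.
  apply: eq_integral => x _; rewrite -!EFinM !normal_pdfE//; congr EFin.
  rewrite mulrCA [RHS]mulrCA; congr (_ * _); rewrite /normal_fun -!expRD.
  by congr expR; rewrite -mulr_natr; field.
rewrite ge0_integralZl//.
- by rewrite integral_normal_pdf mule1.
- by apply/measurable_EFinP; exact: measurable_normal_pdf.
- by move=> x _; rewrite lee_fin normal_pdf_ge0.
Qed.

(** On a window of width [s] the density is at least its value at distance [|x - m| + s] from the
    mean, and the width cancels the factor [1 / s] of the peak. *)
Lemma normal_prob_itv_ge m s a b x : 0 < s -> a <= b -> b - a = s ->
  (forall y, a <= y <= b -> `|y - m| <= `|x - m| + s) ->
  ((expR (- (`|x - m| / s + 1) ^+ 2 / 2) / Num.sqrt (2 * pi))%:E <=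
   normal_prob m s `[a, b])%E.
Proof.
move=> s0 ab bas xy.
have sn0 : s != 0 by rewrite gt_eqF.
have pi0 := @pi_gt0 R.
rewrite /normal_prob.
pose c := expR (- (`|x - m| / s + 1) ^+ 2 / 2) * normal_peak s.
apply: (@le_trans _ _ (\int[leb]_(y in `[a, b]) c%:E)%E).
  rewrite integral_cst//= lebesgue_measure_itv/= lte_fin.
  rewrite -EFinD bas; case: ifPn => [_|]; last first.
    by rewrite -subr_gt0 bas s0.
  rewrite -EFinM lee_fin /c -mulrA ler_pM2l ?expR_gt0// /normal_peak.
  rewrite -mulrnAr [in leRHS]sqrtrM ?sqr_ge0// sqrtr_sqr gtr0_norm//.
  by rewrite invfM mulrAC mulVf// mul1r mulr_natl.
apply: ge0_le_integral => //=.
- by move=> y _; rewrite lee_fin mulr_ge0 ?expR_ge0// normal_peak_ge0.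
- by apply/measurable_EFinP/measurable_funTS; exact: measurable_normal_pdf.
- move=> y /= /[!in_itv]/= /xy yx; rewrite lee_fin normal_pdfE// /c mulrC.
  rewrite ler_pM2l ?normal_peak_gt0// /normal_fun ler_expR.
  rewrite -[s ^+ 2 *+ 2]mulr_natr invfM mulrA !mulNr lerN2 ler_pM2r//.
  rewrite -expr_div_n -(real_normK (num_real ((y - m) / s))).
  rewrite lerXn2r ?nnegrE//.
    by rewrite addr_ge0// divr_ge0// ltW.
  rewrite normrM normfV [ `|s|]gtr0_norm//.
  by rewrite -(divff sn0) -mulrDl ler_pM2r ?invr_gt0.
Qed.

Lemma normal_prob_upper_tail_ge m s x : 0 < s ->
  ((expR (- (`|x - m| / s + 1) ^+ 2 / 2) / Num.sqrt (2 * pi))%:E <=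
   normal_prob m s [set y | (x <= y)%R])%E.
Proof.
move=> s0; apply: (@le_trans _ _ (normal_prob m s `[x, x + s])).
  apply: normal_prob_itv_ge => //; [lra|lra|].
  move=> y /andP[xy yx]; rewrite -(subrK x y) -addrA addrC.
  rewrite (le_trans (ler_normD _ _))// lerD2l ler_norml; lra.
apply: le_measure; rewrite ?inE//.
  by rewrite -[X in measurable X]set_itvcy; exact: measurable_itv.
by move=> y /=; rewrite in_itv/= => /andP[].
Qed.

Lemma normal_prob_lower_tail_ge m s x : 0 < s ->
  ((expR (- (`|x - m| / s + 1) ^+ 2 / 2) / Num.sqrt (2 * pi))%:E <=
   normal_prob m s [set y | (y <= x)%R])%E.
Proof.
move=> s0; apply: (@le_trans _ _ (normal_prob m s `[x - s, x])).
  apply: normal_prob_itv_ge => //; [lra|lra|].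
  move=> y /andP[xy yx]; rewrite -(subrK x y) -addrA addrC.
  rewrite (le_trans (ler_normD _ _))// lerD2l ler_norml; lra.
apply: le_measure; rewrite ?inE//.
  by rewrite -[X in measurable X]set_itvNyc; exact: measurable_itv.
by move=> y /=; rewrite in_itv/= => /andP[].
Qed.

End normal.

(** * Probability that an arm is not the best *)

(** Tonelli along [consT] peels off the first coordinate. Independence of the posterior marginals
    enters the proof through this formula. *)
Lemma integral_tuple_prob_prod d (T : measurableType d) (R : realType) n
    (Q : 'I_n -> probability T R) (f : 'I_n -> T -> R) :
  (forall i, measurable_fun setT (f i)) -> (forall i x, 0 <= f i x) ->
  (\int[tuple_prob Q]_t (\prod_(i < n) f i (tnth t i))%:E =
   \prod_(i < n) \int[Q i]_x (f i x)%:E)%E.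
Proof.
elim: n Q f => [|n IHn] Q f mf f0.
  rewrite big_ord0 /=; under eq_integral do rewrite big_ord0.
  by rewrite integral_cst// mul1e; exact: probability_setT.
have mp k (g : 'I_k -> T -> R) : (forall i, measurable_fun setT (g i)) ->
    measurable_fun setT (fun t : k.-tuple T => \prod_(i < k) g i (tnth t i)).
  move=> mg; apply: measurable_prod => i _.
  by apply: measurableT_comp => //; exact: measurable_tnth.
have mpE k (g : 'I_k -> T -> R) : (forall i, measurable_fun setT (g i)) ->
    measurable_fun setT
      (fun t : k.-tuple T => (\prod_(i < k) g i (tnth t i))%:E).
  by move=> mg; apply/measurable_EFinP; exact: mp.
have p0 k (g : 'I_k -> T -> R) (t : k.-tuple T) : (forall i x, 0 <= g i x) ->
    0 <= \prod_(i < k) g i (tnth t i) by move=> g0; exact: prodr_ge0.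
rewrite /= ge0_integral_distribution; last 2 first.
- exact: mpE.
- by move=> t; rewrite lee_fin; exact: p0.
rewrite fubini_tonelli1/=; last 2 first.
- exact: (measurableT_comp (mpE _ _ mf) (@measurable_consT _ T n)).
- by move=> t; rewrite lee_fin; exact: p0.
rewrite big_ord_recl -IHn//.
rewrite -ge0_integralZr//; last 3 first.
- exact/measurable_EFinP.
- by move=> x _; rewrite lee_fin.
- apply: integral_ge0 => t _; rewrite lee_fin.
  exact: (p0 _ (fun i => f (lift ord0 i))).
apply: eq_integral => x _; rewrite /fubini_F.
under eq_integral.
  move=> y _; rewrite /consT/= big_ord_recl EFinM tnth0.
  under eq_bigr do rewrite tnthS.
  over.
rewrite ge0_integralZl//.
- exact: (mpE _ (fun i => f (lift ord0 i))).
- by move=> t _; rewrite lee_fin; exact: (p0 _ (fun i => f (lift ord0 i))).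
- by rewrite lee_fin.
Qed.

Section best_arm.
Context (R : realType) (n : nat) (m s : 'I_n -> R) (i : 'I_n).
Hypothesis s_gt0 : forall j, 0 < s j.
Local Notation Pi := (tuple_prob (fun j => normal_prob (m j) (s j)) :
  probability (n.-tuple (measurableTypeR R)) R).
Local Notation best :=
  [set theta : n.-tuple (measurableTypeR R) |
    forall j, j != i -> tnth theta j < tnth theta i].

Let measurable_best : measurable best.
Proof.
rewrite [X in measurable X](_ : _ = \bigcap_(j in [set j | j != i])
    [set theta : n.-tuple (measurableTypeR R) | tnth theta j < tnth theta i]).
  apply: fin_bigcap_measurable => [|j _]; first exact: finite_finset.
  rewrite -[X in measurable X]setTI.
  under eq_set do rewrite -lte_fin.
  apply: measurable_lte => //; apply/measurable_EFinP; exact: measurable_tnth.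
by apply/seteqP; split => theta.
Qed.

Let integral_one k :
  (\int[normal_prob (m k) (s k)]_x (cst 1 x : R)%:E = 1)%E.
Proof.
by rewrite (integral_cst _ measurableT 1%E) mul1e; exact: probability_setT.
Qed.

Let one_sub_best : (1 - fine (Pi best))%:E = Pi (~` best).
Proof.
rewrite probability_setC// EFinB fineK//.
exact: fin_num_measure.
Qed.

(** If arm [i] is not the best, some [theta_j] is at least [theta_i]: a union bound over [j], with a
    Chernoff bound for each pair. The parameters [l j] stay free, to be tuned to the allocation
    later. *)
Lemma one_sub_best_le (l : 'I_n -> R) :
  (forall j, 0 <= l j) ->
  1 - fine (Pi best) <= \sum_(j | j != i)
    expR (l j * (m j - m i) + l j ^+ 2 * (s j ^+ 2 + s i ^+ 2) / 2).
Proof.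
move=> l0; rewrite -lee_fin one_sub_best.
pose r := [seq j <- index_enum 'I_n | j != i].
have mtnth (j : 'I_n) : measurable_fun setT
    (fun theta : n.-tuple (measurableTypeR R) => (tnth theta j : R)).
  exact: measurable_tnth.
have mexp j : measurable_fun setT (fun theta : n.-tuple (measurableTypeR R) =>
    (expR (l j * (tnth theta j - tnth theta i)))%:E).
  apply/measurable_EFinP/measurableT_comp => //; apply: measurable_funM => //.
  exact: measurable_funB.
rewrite -[X in Pi X]setIT -integral_indic//; last exact: measurableC.
apply: (@le_trans _ _ (\int[Pi]_theta \sum_(j <- r)
    (expR (l j * (tnth theta j - tnth theta i)))%:E)%E).
  apply: ge0_le_integral => //.
  - apply/measurable_EFinP; exact/measurable_indic/measurableC.
  - exact: emeasurable_sum.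
  move=> theta _; rewrite sumEFin lee_fin indicE.
  have [|_] := boolP (theta \in _); last by apply: sumr_ge0.
  rewrite inE /= => /existsNP[j /not_implyP[ji /negP]]; rewrite -leNgt => ij.
  rewrite big_filter (bigD1 j)//= ler_wpDr ?sumr_ge0// -expR0 ler_expR.
  by rewrite mulr_ge0// subr_ge0.
rewrite ge0_integral_sum// big_filter -sumEFin; apply: lee_sum => j ji.
(* The exponential becomes a product over all coordinates, with factor 1 off [i] and [j], so its
   integral is a product of two moment generating functions. *)
pose f (k : 'I_n) : measurableTypeR R -> R :=
  if k == j then fun x => expR (l j * x) else
  if k == i then fun x => expR (- l j * x) else cst 1.
have fE (g : 'I_n -> \bar R) : (forall k, k != j -> k != i -> g k = 1%E) ->
    (\prod_k g k = g j * g i)%E.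
  move=> g1; rewrite (bigD1 j)//= (bigD1 i) 1?eq_sym//= big1 ?mule1//.
  by move=> k /andP[]; exact: g1.
under eq_integral => theta _.
  have -> : expR (l j * (tnth theta j - tnth theta i)) =
      \prod_k f k (tnth theta k).
    apply: EFin_inj; rewrite -prodEFin fE.
      have ij : (i == j) = false by rewrite eq_sym (negPf ji).
      rewrite /f ij !eqxx -EFinM -expRD.
      by rewrite mulrBr mulNr.
    by move=> k kj ki; rewrite /f (negPf kj) (negPf ki).
  over.
rewrite integral_tuple_prob_prod; last 2 first.
- move=> k; rewrite /f; case: ifP => _; [|case: ifP => _ //].
  + by apply: measurableT_comp => //; exact: measurable_funM.
  + by apply: measurableT_comp => //; exact: measurable_funM.
- by move=> k x; rewrite /f; case: ifP => _; [|case: ifP].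
rewrite fE; last first.
  move=> k kj ki; rewrite /f (negPf kj) (negPf ki).
  exact: integral_one.
have ij : (i == j) = false by rewrite eq_sym (negPf ji).
rewrite /f ij !eqxx !normal_mgf ?gt_eqF//.
rewrite -EFinM -expRD lee_fin ler_expR sqrrN le_eqVlt.
by apply/orP; left; apply/eqP; field.
Qed.

Let c : R := (Num.sqrt (2 * pi))^-1.

(** If [theta_i <= x <= theta_j], arm [i] is not strictly the best, and this event is a product of
    two one-sided tails. *)
Lemma one_sub_best_ge (j : 'I_n) x : j != i ->
  expR (- (`|x - m i| / s i + 1) ^+ 2 / 2) * c *
    (expR (- (`|x - m j| / s j + 1) ^+ 2 / 2) * c) <=
  1 - fine (Pi best).
Proof.
move=> ji; rewrite -lee_fin one_sub_best.
have mge : measurable [set y : measurableTypeR R | x <= y].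
  by rewrite -[X in measurable X]set_itvcy; exact: measurable_itv.
have mle : measurable [set y : measurableTypeR R | y <= x].
  by rewrite -[X in measurable X]set_itvNyc; exact: measurable_itv.
pose f (k : 'I_n) : measurableTypeR R -> R :=
  if k == i then \1_[set y | y <= x] else
  if k == j then \1_[set y | x <= y] else cst 1.
have fE (g : 'I_n -> \bar R) : (forall k, k != i -> k != j -> g k = 1%E) ->
    (\prod_k g k = g i * g j)%E.
  move=> g1; rewrite (bigD1 i)//= (bigD1 j)//= big1 ?mule1//.
  by move=> k /andP[]; exact: g1.
have mf k : measurable_fun setT (f k).
  by rewrite /f; case: ifP => _; [|case: ifP => _ //]; exact: measurable_indic.
have f0 k y : 0 <= f k y.
  by rewrite /f; case: ifP => _; [|case: ifP => _ //].
apply: (@le_trans _ _ (\int[Pi]_theta (\prod_k f k (tnth theta k))%:E)%E).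
  rewrite integral_tuple_prob_prod// fE; last first.
    move=> k ki kj; rewrite /f (negPf kj) (negPf ki).
    exact: integral_one.
  rewrite /f eqxx (negPf ji) eqxx !integral_indic// !setIT EFinM.
  rewrite lee_pmul//.
  - by rewrite lee_fin mulr_ge0 ?expR_ge0// /c invr_ge0 sqrtr_ge0.
  - by rewrite lee_fin mulr_ge0 ?expR_ge0// /c invr_ge0 sqrtr_ge0.
  - exact: normal_prob_lower_tail_ge.
  - exact: normal_prob_upper_tail_ge.
rewrite -[X in (_ <= Pi X)%E]setIT -integral_indic//; last exact: measurableC.
apply: ge0_le_integral => //.
- by move=> theta _; rewrite lee_fin prodr_ge0.
- apply/measurable_EFinP/measurable_prod => k _.
  by apply: measurableT_comp => //; exact: measurable_tnth.
- by apply/measurable_EFinP; exact/measurable_indic/measurableC.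
move=> theta _.
have -> : (\prod_k f k (tnth theta k))%:E =
    ((f i (tnth theta i))%:E * (f j (tnth theta j))%:E)%E.
  rewrite -prodEFin fE// => k ki kj.
  by rewrite /f (negPf kj) (negPf ki).
rewrite -EFinM lee_fin /f eqxx (negPf ji) eqxx !indicE.
have [ix|] := boolP (_ \in [set y | y <= x]); last by rewrite mul0r.
have [jx|] := boolP (_ \in [set y | x <= y]); last by rewrite mulr0.
rewrite mulr1 (_ : theta \in _ = true)//; apply/mem_set => /(_ _ ji).
move: ix jx; rewrite !inE /= => ix jx.
by apply/negP; rewrite -leNgt (le_trans ix).
Qed.

End best_arm.

(** * Integrating out a variable independent of the past *)

Section freezing.
Context d d' (Omega : measurableType d) (T : measurableType d') (R : realType)
  (P : probability Omega R) (G : set (set Omega)) (X : {RV P >-> T}).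
Local Notation gT := (g_sigma_algebraType G).
Hypotheses (Gmeas : G `<=` measurable) (GT : G setT) (GI : setI_closed G).
Hypothesis indep : forall A C, G A -> measurable C ->
  P (A `&` X @^-1` C) = (P A * P (X @^-1` C))%E.

Lemma measurable_id_g_sigma : measurable_fun [set: Omega] (id : Omega -> gT).
Proof.
move=> _ A mA; rewrite setTI preimage_id.
by apply: (smallest_sub (@sigma_algebra_measurable _ Omega) Gmeas).
Qed.

(** As functions of [A], both sides are finite measures, a restriction and a rescaling of [P]. They
    agree on the pi-system [G], hence on the sigma-algebra it generates. *)
Lemma independent_g_sigma A C : <<s G >> A -> measurable C ->
  P (A `&` X @^-1` C) = (P A * P (X @^-1` C))%E.
Proof.
move=> GA mC.
have mX : measurable (X @^-1` C).
  by rewrite -[X in measurable X]setTI; exact: measurable_funPT.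
have fX : P (X @^-1` C) \is a fin_num by exact: fin_num_measure.
have fX0 : 0 <= fine (P (X @^-1` C)) by rewrite fine_ge0.
rewrite -[LHS]/(mrestr P mX A) muleC -[in RHS](fineK fX).
rewrite -[RHS]/(mscale (NngNum fX0) P A).
apply: (@g_sigma_algebra_measure_unique _ _ _ G Gmeas (fun=> setT)) => //.
- by rewrite bigcup_const.
- move=> B GB; rewrite -[LHS]/(P (B `&` X @^-1` C)) indep// muleC.
  by rewrite -[in LHS](fineK fX).
- move=> _; rewrite -[X in (X < _)%E]/(P (setT `&` X @^-1` C)) setTI.
  apply: le_lt_trans (ltry 1); exact: probability_le1.
Qed.

(* [f] may use the whole of [w] as long as it is measurable for the
   sigma-algebra generated by [G]: apply Fubini to the law of [(id, X)], where
   [id] takes values in [Omega] with that smaller sigma-algebra. *)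
Lemma ge0_integral_freezing (f : gT * T -> \bar R) :
  measurable_fun setT f -> (forall z, 0 <= f z)%E ->
  (\int[P]_w f (w, X w) = \int[P]_w \int[distribution P X]_y f (w, y))%E.
Proof.
move=> mf f0.
pose idG : Omega -> gT := id.
have midG : measurable_fun setT idG by exact: measurable_id_g_sigma.
have mZ : measurable_fun setT (fun w => (idG w, X w)).
  by apply: measurable_fun_pair.
pose PG := distribution P (mfun_Sub (mem_set midG) : {RV P >-> gT}).
pose Z := mfun_Sub (mem_set mZ) : {RV P >-> (gT * T)%type}.
transitivity (\int[distribution P Z]_z f z)%E.
  by rewrite ge0_integral_distribution.
transitivity (\int[PG \x distribution P X]_z f z)%E.
  apply: eq_measure_integral => A mA _; apply/esym.
  apply: product_measure_unique => // B C mB mC.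
  exact: independent_g_sigma.
rewrite fubini_tonelli1// ge0_integral_distribution//.
- exact: measurable_fun_fubini_tonelli_F.
- by move=> w; apply: integral_ge0.
Qed.

End freezing.

(** * The filtration of a sampling rule *)

Section adapted.
Context (R : realType) (K : nat) d (Omega : measurableType d)
  (P : probability Omega R) (Y : nat -> 'I_K.+2 -> {RV P >-> R})
  (I : nat -> Omega -> 'I_K.+2).
Local Notation arm := 'I_K.+2.
Context dU (S : measurableType dU) (U : {RV P >-> S})
  (rule : forall n, n.-tuple arm -> S * n.-tuple R -> arm).
Hypotheses
  (HYind : mutually_independent P
     (fun ni : nat * arm => sigma_rv (Y ni.1 ni.2)))
  (HU : independent P (sigma_rv U)
     <<s \bigcup_(ni : nat * arm) sigma_rv (Y ni.1 ni.2) >>)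
  (mrule : forall n (a : n.-tuple arm) i, measurable [set x | rule a x = i])
  (IE : forall n w, I n w = rule [tuple I l w | l < n]
    (U w, [tuple (Y l (I l w) : Omega -> R) w | l < n])).

Let past n : {fset nat * arm} :=
  [fset p in [seq (l, j) | l <- iota 0 n, j <- enum 'I_K.+2]]%fset.

Let in_past n p : (p \in past n) = (p.1 < n)%N.
Proof.
rewrite in_fset /=; apply/allpairsP/idP => [[[l j] /= [+ _ ->]]|pn].
  by rewrite mem_iota.
by exists p; rewrite mem_iota mem_enum; case: p pn.
Qed.

Let cylinder n (B : set S) (D : nat * arm -> set R) : set Omega :=
  U @^-1` B `&` \bigcap_(p in [set` past n]) Y p.1 p.2 @^-1` D p.

(** A pi-system of cylinders, on which independence can be checked directly. It involves the seed
    and all rewards of earlier rounds, observed or not, so that its index set does not depend on the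
    random path of arms. *)
Definition history n : set (set Omega) := [set A | exists B D,
  [/\ measurable B, forall p, measurable (D p) & A = cylinder n B D]].

Let mY (p : nat * arm) (D : set R) : measurable D ->
  measurable (Y p.1 p.2 @^-1` D).
Proof.
by move=> mD; rewrite -[X in measurable X]setTI; exact: measurable_funPT.
Qed.

Let mU (B : set S) : measurable B -> measurable (U @^-1` B).
Proof.
by move=> mB; rewrite -[X in measurable X]setTI; exact: measurable_funPT.
Qed.

Lemma history_measurable n : history n `<=` measurable.
Proof.
move=> _ [B [D [mB mD ->]]]; apply: measurableI; first exact: mU.
apply: fin_bigcap_measurable; first exact: finite_fset.
by move=> p _; exact: mY.
Qed.

Lemma history_setT n : history n setT.
Proof.
exists setT, (fun=> setT); split=> //.
apply/seteqP; split=> // w _; split=> // p _ //.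
Qed.

Lemma history_setI n : setI_closed (history n).
Proof.
move=> _ _ [B [D [mB mD ->]]] [B' [D' [mB' mD' ->]]].
exists (B `&` B'), (fun p => D p `&` D' p); split.
- exact: measurableI.
- by move=> p; exact: measurableI.
- apply/seteqP; split=> [w [[Bw Dw] [B'w D'w]]|w [[Bw B'w] Dw]].
    by split=> // p pn; split; [exact: Dw|exact: D'w].
  by split; split=> // p pn; have [] := Dw p pn.
Qed.

(** The seed splits off by [HU], being independent of all rewards jointly; the rewards then factor
    by mutual independence, since the index [(n, i)] is not in [past n]. *)
Lemma history_indep n i A C : history n A -> measurable C ->
  P (A `&` Y n i @^-1` C) = (P A * P (Y n i @^-1` C))%E.
Proof.
move=> [B [D [mB mD ->]]] mC.
pose F (p : nat * arm) := Y p.1 p.2 @^-1` D p.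
pose W := \bigcap_(p in [set` past n]) F p.
(* Patching [D] at [(n, i)] turns the event into a single intersection over a finite set of
   indices. *)
pose D' p := if p == (n, i) then C else D p.
pose F' (p : nat * arm) := Y p.1 p.2 @^-1` D' p.
have mD' p : measurable (D' p) by rewrite /D'; case: ifP.
have niN : (n, i) \notin past n by rewrite in_past/= ltnn.
have F'E p : p \in past n -> F' p = F p.
  move=> pn; rewrite /F' /D'; case: eqP => // pE.
  by move: niN; rewrite -pE pn.
have F'ni : F' (n, i) = Y n i @^-1` C by rewrite /F' /D' eqxx.
have WE : W `&` Y n i @^-1` C =
    \bigcap_(p in [set` ((n, i) |` past n)%fset]) F' p.
  apply/seteqP; split=> [w [Ww Cw] p /=|w H].
    rewrite in_fset1U => /predU1P[->|pn]; first by rewrite F'ni.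
    by rewrite F'E//; exact: Ww.
  split; last by rewrite -F'ni; apply: H; rewrite /= in_fset1U eqxx.
  by move=> p pn; rewrite -F'E//; apply: H; rewrite /= in_fset1U pn orbT.
have sF p (E : set R) : measurable E ->
    sigma_rv (Y p.1 p.2) (Y p.1 p.2 @^-1` E).
  by move=> mE; exists E => //; rewrite setTI.
pose sY := \bigcup_(ni : nat * arm) sigma_rv (Y ni.1 ni.2).
have sFY p (E : set R) : measurable E ->
    (measurable (Y p.1 p.2 @^-1` E : set (g_sigma_algebraType sY))).
  by move=> mE; apply: sub_sigma_algebra; exists p => //; exact: sF.
have mW : measurable (W : set (g_sigma_algebraType sY)).
  apply: fin_bigcap_measurable; first exact: finite_fset.
  by move=> p _; exact: sFY.
have mWC : measurable (W `&` Y n i @^-1` C : set (g_sigma_algebraType sY)).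
  by apply: measurableI => //; exact: (sFY (n, i)).
have UB : sigma_rv U (U @^-1` B) by exists B => //; rewrite setTI.
rewrite /cylinder -/W -setIA (HU UB mWC) (HU UB mW) -muleA; congr (_ * _)%E.
rewrite WE HYind; last by move=> p _; exact: sF.
rewrite big_fsetU1//= F'ni muleC; congr (_ * _)%E.
rewrite HYind; last by move=> p _; exact: sF.
by apply: eq_big_seq => p /F'E ->.
Qed.

Local Notation Hist n := (g_sigma_algebraType (history n)).

Lemma history_Y n l i : (l < n)%N ->
  measurable_fun [set: Hist n] (Y l i : Omega -> R).
Proof.
move=> ln _ C mC; rewrite setTI; apply: sub_sigma_algebra.
exists setT, (fun p => if p == (l, i) then C else setT); split=> //.
  by move=> p; case: ifP.
apply/seteqP; split=> [w Cw|w [_ /(_ (l, i))]].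
  by split=> // p _ /=; case: eqP => // ->.
by rewrite /= in_past eqxx; exact.
Qed.

Lemma history_U n : measurable_fun [set: Hist n] (U : Omega -> S).
Proof.
move=> _ C mC; rewrite setTI; apply: sub_sigma_algebra.
exists C, (fun=> setT); split=> //.
by apply/seteqP; split=> [w Cw|w []].
Qed.

(** Strong induction on [l], splitting over the finitely many sequences [a] of earlier arms. Once
    [a] is fixed, the observed rewards are the fixed variables [Y k (tnth a k)] and [mrule]
    applies. *)
Lemma history_arm n l i : (l <= n)%N ->
  measurable ([set w | I l w = i] : set (Hist n)).
Proof.
elim/ltn_ind: l i => l IHl i ln.
rewrite [X in measurable X](_ : _ = \bigcup_(a in [set: l.-tuple arm])
    (\bigcap_(k in [set: 'I_l]) [set w | I k w = tnth a k] `&`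
     [set w | rule a
       (U w, [tuple (Y k (tnth a k) : Omega -> R) w | k < l]) = i]));
  last first.
  apply/seteqP; split=> [w /= Iw|w [a _ [aw /= <-]]].
    exists [tuple I k w | k < l] => //; split.
      by move=> k _ /=; rewrite tnth_mktuple.
    move=> /=; rewrite -[RHS]Iw IE; congr (rule _ (_, _)).
    by apply: eq_from_tnth => k; rewrite !tnth_mktuple.
  rewrite /= IE; have -> : [tuple I k w | k < l] = a.
    by apply: eq_from_tnth => k; rewrite tnth_mktuple aw.
  congr (rule _ (_, _)); apply: eq_from_tnth => k.
  by rewrite !tnth_mktuple aw.
apply: fin_bigcup_measurable; first exact: finite_finset.
move=> a _; apply: measurableI.
  apply: fin_bigcap_measurable; first exact: finite_finset.
  by move=> k _; apply: IHl => //; exact: (leq_trans (ltnW (ltn_ord k))).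
have mZ : measurable_fun [set: Hist n] (fun w : Omega =>
    (U w, [tuple (Y k (tnth a k) : Omega -> R) w | k < l])).
  apply: measurable_fun_pair; first exact: history_U.
  apply/measurable_fun_tnthP => k.
  rewrite (_ : _ \o _ = (Y k (tnth a k) : Omega -> R)); last first.
    by apply/funext => w /=; rewrite tnth_mktuple.
  by apply: history_Y; exact: (leq_trans (ltn_ord k)).
by rewrite -[X in measurable X]setTI; exact: mZ (mrule a i).
Qed.

Lemma history_pull n l i : (l <= n)%N ->
  measurable_fun [set: Hist n] (fun w : Omega => (I l w == i)%:R : R).
Proof.
move=> ln; rewrite [X in measurable_fun _ X](_ : _ = \1_[set w | I l w = i]).
  by apply: measurable_indic; exact: history_arm.
apply/funext => w; rewrite indicE (_ : (w \in _) = (I l w == i))//.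
by apply/idP/eqP; rewrite inE.
Qed.

End adapted.

(** * The exponential martingale *)

(* The law of a real random variable is a measure on [R], whereas [normal_prob]
   is a measure on the copy [measurableTypeR R]. *)
Definition of_measurableTypeR (R : realType) (y : measurableTypeR R) : R := y.

Lemma measurable_of_measurableTypeR (R : realType) :
  measurable_fun setT (@of_measurableTypeR R).
Proof. by move=> _ A mA; rewrite setTI. Qed.

HB.instance Definition _ (R : realType) := isMeasurableFun.Build _ _ _ _
  (@of_measurableTypeR R) (@measurable_of_measurableTypeR R).

Section martingale.
Context (R : realType) (K : nat) d (Omega : measurableType d)
  (P : probability Omega R) (mu : 'I_K.+2 -> R) (sigma : R)
  (Y : nat -> 'I_K.+2 -> {RV P >-> R}) (I : nat -> Omega -> 'I_K.+2).
Hypotheses (sigma_gt0 : 0 < sigma) (HY : gaussian_rewards mu sigma Y)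
  (HI : sampling_rule Y I).
Implicit Types (i : 'I_K.+2) (w : Omega).

Definition noise n i w : R := \sum_(l < n) (I l w == i)%:R * (Y l i w - mu i).

Definition exp_mart (l : R) n i w : R :=
  expR (l * noise n i w - l ^+ 2 * sigma ^+ 2 / 2 * (pulls I n i w)%:R).

Let exp_martS l n i w : exp_mart l n.+1 i w = exp_mart l n i w *
  expR ((I n w == i)%:R * (l * (Y n i w - mu i) - l ^+ 2 * sigma ^+ 2 / 2)).
Proof.
rewrite /exp_mart /noise /pulls !big_ord_recr /= -expRD; congr expR.
by rewrite natrD; ring.
Qed.

Let normal_step l i (b : bool) :
  (\int[normal_prob (mu i) sigma]_y
    (expR (b%:R * (l * (y - mu i) - l ^+ 2 * sigma ^+ 2 / 2)))%:E = 1)%E.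
Proof.
case: b; last first.
  under eq_integral do rewrite mul0r expR0.
  rewrite (integral_cst _ measurableT 1%E) mul1e.
  exact: (@probability_setT _ _ _ (normal_prob (mu i) sigma)).
pose c := expR (- (l * mu i + l ^+ 2 * sigma ^+ 2 / 2)).
transitivity (\int[normal_prob (mu i) sigma]_y (c%:E * (expR (l * y))%:E))%E.
  apply: eq_integral => y _; rewrite -EFinM -expRD; congr (_%:E); congr expR.
  by rewrite mul1r; ring.
rewrite ge0_integralZl//.
- by rewrite normal_mgf ?gt_eqF// -EFinM -expRD addrC subrr expR0.
- by apply/measurable_EFinP; apply: measurableT_comp.
- by rewrite lee_fin expR_ge0.
Qed.

Let integral_rewardE n i (f : R -> \bar R) :
  measurable_fun [set: R] f -> (forall y, 0 <= f y)%E ->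
  (\int[distribution P (Y n i)]_y f y =
   \int[normal_prob (mu i) sigma]_y f y)%E.
Proof.
move=> mf f0.
pose X : {RV (normal_prob (mu i) sigma) >-> R} := @of_measurableTypeR R.
transitivity (\int[distribution (normal_prob (mu i) sigma) X]_y f y)%E.
  apply: eq_measure_integral => A mA _.
  exact: HY.2.
by rewrite ge0_integral_distribution.
Qed.

(** Induction on [n]. Both [exp_mart l n i] and the choice [I n] are measurable for the history, so
    they can be frozen while the reward of round [n] is integrated out by [normal_step]. *)
Lemma exp_mart_expectation l n i : measurable_fun setT (exp_mart l n i) /\
  (\int[P]_w (exp_mart l n i w)%:E = 1)%E.
Proof.
case: HI => dU [S [U [rule [HU mrule IE]]]].
have mN n' : measurable_fun [set: g_sigma_algebraType (history Y U n')]
    (noise n' i).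
  apply: measurable_sum => k; apply: measurable_funM.
    exact: (history_pull mrule IE _ (ltnW (ltn_ord k))).
  by apply: measurable_funB => //; exact: history_Y.
have mT n' : measurable_fun [set: g_sigma_algebraType (history Y U n')]
    (fun w => (pulls I n' i w)%:R : R).
  under eq_fun do rewrite natr_sum.
  apply: measurable_sum => k.
  exact: (history_pull mrule IE _ (ltnW (ltn_ord k))).
have mM n' : measurable_fun [set: g_sigma_algebraType (history Y U n')]
    (exp_mart l n' i).
  apply: measurableT_comp => //; apply: measurable_funB.
    by apply: measurable_funM.
  by apply: measurable_funM.
split.
  have mid := measurable_id_g_sigma (@history_measurable _ _ _ _ P Y _ _ U n).
  by apply: (measurableT_comp (mM n) mid).
elim: n => [|n IHn].
  rewrite -[RHS](@probability_setT _ _ _ P) -[RHS]mul1e.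
  rewrite -(integral_cst _ measurableT 1%E); apply: eq_integral => w _.
  by rewrite /exp_mart /noise /pulls !big_ord0 mulr0 mulr0 subr0 expR0.
pose f (z : g_sigma_algebraType (history Y U n) * R) : \bar R :=
  (exp_mart l n i z.1 * expR ((I n z.1 == i)%:R *
    (l * (z.2 - mu i) - l ^+ 2 * sigma ^+ 2 / 2)))%:E.
have mf : measurable_fun setT f.
  apply/measurable_EFinP; apply: measurable_funM.
    exact: (measurableT_comp (mM n) measurable_fst).
  apply: measurableT_comp => //; apply: measurable_funM.
    have := history_pull mrule IE i (leqnn n).
    by move/measurableT_comp; apply; exact: measurable_fst.
  apply: measurable_funB => //; apply: measurable_funM => //.
  by apply: measurable_funB.
rewrite -[RHS]IHn; transitivity (\int[P]_w f (w, Y n i w))%E.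
  by apply: eq_integral => w _; rewrite exp_martS.
rewrite (ge0_integral_freezing (@history_measurable _ _ _ _ P Y _ _ U n)
  (@history_setT _ _ _ _ P Y _ _ U n) (@history_setI _ _ _ _ P Y _ _ U n)
  (@history_indep _ _ _ _ P Y _ _ U HY.1 HU n i) mf); last first.
  by move=> z; rewrite lee_fin mulr_ge0 ?expR_ge0.
apply: eq_integral => w _.
transitivity (\int[normal_prob (mu i) sigma]_y f (w, y))%E.
  apply: integral_rewardE; first exact: (measurableT_comp mf).
  by move=> y; rewrite lee_fin mulr_ge0 ?expR_ge0.
rewrite /f; under eq_integral do rewrite EFinM /=.
rewrite ge0_integralZl//.
- by rewrite normal_step mule1.
- apply/measurable_EFinP; apply: measurableT_comp => //.
  apply: measurable_funM => //; apply: measurable_funB => //.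
  by apply: measurable_funM => //; exact: measurable_funB.
- by rewrite lee_fin expR_ge0.
Qed.

End martingale.

(** * Borel-Cantelli and almost sure control of the noise *)

Lemma nneseries_geometric_lty (R : realType) (u : nat -> \bar R) (a r : R) :
  0 <= a -> 0 < r < 1 -> (forall n, 0 <= u n)%E ->
  (forall n, u n <= (a * r ^+ n)%:E)%E -> (\sum_(n <oo) u n < +oo)%E.
Proof.
move=> a0 /andP[r0 r1] u0 ur; apply: le_lt_trans (ltry (a / (1 - r))).
apply: lime_le; first exact: is_cvg_nneseries.
apply: nearW => n; apply: (@le_trans _ _ (\sum_(0 <= k < n) (a * r ^+ k)%:E)%E).
  exact: lee_sum.
rewrite sumEFin lee_fin.
have -> : \sum_(0 <= k < n) a * r ^+ k = series (geometric a r) n by [].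
rewrite geometric_seriesE ?lt_eqF//=.
rewrite ler_pM2r ?invr_gt0 ?subr_gt0// ler_piMr// lerBlDl lerDr.
by rewrite exprn_ge0// ltW.
Qed.

(** Markov's inequality bounds the exceptional probabilities by
    [C * n.+1%:R * expR (- (c * n.+1%:R))], which is summable, and Borel-Cantelli applies. *)
Lemma ae_near_lt_expR d (T : measurableType d) (R : realType)
    (P : probability T R) (X : nat -> T -> R) (C c : R) : 0 < c -> 0 <= C ->
  (forall n, measurable_fun setT (X n)) -> (forall n w, 0 <= X n w) ->
  (forall n, \int[P]_w (X n w)%:E <= (C * n.+1%:R)%:E)%E ->
  {ae P, forall w, \forall n \near \oo, X n w < expR (c * n.+1%:R)}.
Proof.
move=> c0 C0 mX X0 XC.
pose F n := [set w | (expR (c * n.+1%:R))%:E <= (X n w)%:E]%E.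
have mF n : measurable (F n).
  rewrite -[X in measurable X]setTI.
  by apply: measurable_lee => //; exact/measurable_EFinP.
have PF n : (P (F n) <= (C * n.+1%:R * expR (- (c * n.+1%:R)))%:E)%E.
  rewrite expRN EFinM lee_pdivlMr ?expR_gt0//.
  apply: le_trans (XC n).
  rewrite muleC -[F n]setIT -integral_indic// -ge0_integralZl//; last first.
    by apply/measurable_EFinP; exact: measurable_indic.
  apply: ge0_le_integral => //.
  - apply: measurable_funeM; apply/measurable_EFinP; exact: measurable_indic.
  - exact/measurable_EFinP.
  move=> w _; rewrite -EFinM lee_fin indicE.
  have [|_] := boolP (w \in F n); last by rewrite mulr0.
  by rewrite inE /F /= lee_fin mulr1.
(* Half of the exponent absorbs the factor [n.+1%:R], as [x <= expR x] at [x = c / 2 * n.+1%:R]; the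
   other half leaves a geometric series of ratio [r]. *)
pose r := expR (- (c / 2)).
have r01 : 0 < r < 1 by rewrite expR_gt0 -expR0 ltr_expR oppr_lt0 divr_gt0.
have L0 : P (lim_sup_set F) = 0.
  apply: lim_sup_set_cvg0 => //.
  apply: (@nneseries_geometric_lty _ _ (C * (2 / c) * r) r) => //.
    by rewrite !mulr_ge0 ?expR_ge0// invr_ge0 ltW.
  move=> n; apply: (le_trans (PF n)); rewrite lee_fin.
  rewrite -!mulrA ler_wpM2l//.
  have -> : - (c * n.+1%:R) = c / 2 * n.+1%:R * - 1 + - (c / 2) * n.+1%:R.
    by field.
  rewrite expRD expRM_natr -/r.
  have -> : 2 * (c^-1 * (r * r ^+ n)) = 2 / c * r ^+ n.+1.
    by rewrite exprS !mulrA.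
  rewrite mulrA ler_pM2r ?exprn_gt0 ?expR_gt0//.
  rewrite mulrN1 expRN ler_pdivrMr ?expR_gt0//.
  rewrite -ler_pdivrMl ?divr_gt0// invf_div.
  by apply: le_trans (expR_ge1Dx _); rewrite lerDr.
exists (lim_sup_set F); split => //.
  by apply: bigcap_measurableType => n _; apply: bigcup_measurable.
move=> w /= nw n _; apply: contrapT => Fw; apply: nw.
exists n => // j nj /=; rewrite ltNge; apply/negP => Xj; apply: Fw.
by exists j => //; rewrite /F/= lee_fin.
Qed.

Section noise.
Context (R : realType) (K : nat) d (Omega : measurableType d)
  (P : probability Omega R) (mu : 'I_K.+2 -> R) (sigma : R)
  (Y : nat -> 'I_K.+2 -> {RV P >-> R}) (I : nat -> Omega -> 'I_K.+2).
Hypotheses (sigma_gt0 : 0 < sigma) (HY : gaussian_rewards mu sigma Y)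
  (HI : sampling_rule Y I).

Lemma pulls_le n i w : (pulls I n i w <= n)%N.
Proof.
rewrite /pulls -[leqRHS]card_ord -sum1_card; apply: leq_sum => l _.
by case: eqP.
Qed.

(* [l t] is the optimal Chernoff parameter when [T = t]; summing over all the
   values [t <= n] costs only a factor [n + 1] and dispenses with stopping
   times. *)
Lemma exp_mart_ge_noise (e : R) n i w :
  let l (t : nat) := Num.sqrt (e * n.+1%:R / t.+1%:R) / sigma ^+ 2 in
  0 < e ->
  e * n.+1%:R * (pulls I n i w).+1%:R < noise mu Y I n i w ^+ 2 ->
  expR (e / (2 * sigma ^+ 2) * n.+1%:R) <=
  \sum_(t < n.+1) (exp_mart mu sigma Y I (l t) n i w +
                   exp_mart mu sigma Y I (- l t) n i w).
Proof.
move=> l e0; set S := noise _ _ _ _ _ _; set T := pulls _ _ _ _ => TS.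
have Tn : (T < n.+1)%N by rewrite ltnS pulls_le.
have M0 x : 0 <= exp_mart mu sigma Y I x n i w by exact: expR_ge0.
rewrite (bigD1 (Ordinal Tn))//= ler_wpDr//.
  by apply: sumr_ge0 => t _; rewrite addr_ge0.
have s2 : 0 < sigma ^+ 2 by rewrite exprn_gt0.
have T1 : 0 < T.+1%:R :> R by rewrite ltr0n.
have n1 : 0 < n.+1%:R :> R by rewrite ltr0n.
have l0 : 0 <= l T by rewrite /l divr_ge0 ?sqrtr_ge0 ?ltW.
have l2 : l T ^+ 2 = e * n.+1%:R / T.+1%:R / sigma ^+ 2 / sigma ^+ 2.
  rewrite /l expr_div_n sqr_sqrtr; first by rewrite [in LHS]expr2 invfM mulrA.
  by rewrite divr_ge0 ?mulr_ge0 ?ltW.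
have lS : e * n.+1%:R / sigma ^+ 2 <= l T * `|S|.
  have en0 : 0 <= e * n.+1%:R / sigma ^+ 2 by rewrite !mulr_ge0 ?invr_ge0 ?ltW.
  have lS0 : 0 <= l T * `|S| by rewrite mulr_ge0.
  rewrite -(@ler_pXn2r _ 2)//.
  rewrite [leRHS]exprMn l2 real_normK ?num_real//.
  apply: le_trans (ler_wpM2l _ (ltW TS)); last first.
    by rewrite !divr_ge0 ?mulr_ge0 ?ltW.
  rewrite le_eqVlt; apply/orP; left; apply/eqP; field.
  by rewrite !gt_eqF.
(* Here [x] is whichever of [l T] and [- l T] has the sign of the noise. The linear term is at least
   twice the target exponent, and the quadratic term takes away at most half of it because
   [T / T.+1 <= 1]. *)
have bound x : x * S = l T * `|S| -> x ^+ 2 = l T ^+ 2 ->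
    expR (e / (2 * sigma ^+ 2) * n.+1%:R) <= exp_mart mu sigma Y I x n i w.
  move=> xS x2; rewrite /exp_mart ler_expR -/S -/T xS x2 l2.
  apply: le_trans (lerB lS (lexx _)).
  have -> : e * n.+1%:R / T.+1%:R / sigma ^+ 2 / sigma ^+ 2 *
      sigma ^+ 2 / 2 * T%:R = e * n.+1%:R / (2 * sigma ^+ 2) * (T%:R / T.+1%:R).
    by field; rewrite !gt_eqF.
  have T01 : T%:R / T.+1%:R <= 1 :> R by rewrite ler_pdivrMr// mul1r ler_nat.
  have q0 : 0 <= e * n.+1%:R / (2 * sigma ^+ 2).
    by rewrite divr_ge0 ?mulr_ge0// ltW.
  have := ler_wpM2l q0 T01; rewrite mulr1 => H.
  rewrite lerBrDr; apply: le_trans (lerD (lexx _) H) _.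
  by rewrite le_eqVlt; apply/orP; left; apply/eqP; field; rewrite gt_eqF.
have [S0|S0] := leP 0 S.
  by rewrite ler_wpDr// bound// ger0_norm.
by rewrite ler_wpDl// bound ?sqrrN// ltr0_norm// mulNr mulrN.
Qed.

(** The quantifier over [e] is inside the almost sure event, so the estimate is first proved for the
    countably many values [1 / k.+1] and then extended by monotonicity. *)
Lemma ae_noise_small i :
  {ae P, forall w, forall e : R, 0 < e -> \forall n \near \oo,
    noise mu Y I n i w ^+ 2 <= e * n.+1%:R * (pulls I n i w).+1%:R}.
Proof.
pose l (e : R) n (t : nat) := Num.sqrt (e * n.+1%:R / t.+1%:R) / sigma ^+ 2.
pose X e n w := \sum_(t < n.+1) (exp_mart mu sigma Y I (l e n t) n i w +
  exp_mart mu sigma Y I (- l e n t) n i w).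
have ex x n := exp_mart_expectation sigma_gt0 HY HI x n i.
have mE x n : measurable_fun setT (exp_mart mu sigma Y I x n i).
  by case: (ex x n).
have iE x n : (\int[P]_w (exp_mart mu sigma Y I x n i w)%:E = 1)%E.
  by case: (ex x n).
have M0 x n w : 0 <= exp_mart mu sigma Y I x n i w by exact: expR_ge0.
have key (k : nat) : {ae P, forall w, \forall n \near \oo,
    X k.+1%:R^-1 n w < expR (k.+1%:R^-1 / (2 * sigma ^+ 2) * n.+1%:R)}.
  (* The constant 2 counts the two signs: [X] is a sum of [2 * n.+1] variables of mean 1. *)
  apply: (@ae_near_lt_expR _ _ _ P _ 2) => //.
  - by rewrite divr_gt0 ?invr_gt0// mulr_gt0// exprn_gt0.
  - by move=> n; apply: measurable_sum => t; exact: measurable_funD.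
  - by move=> n w; apply: sumr_ge0 => t _; rewrite addr_ge0.
  - move=> n; under eq_integral do rewrite /X -sumEFin.
    rewrite ge0_integral_sum//; last 2 first.
    + by move=> t; apply/measurable_EFinP; exact: measurable_funD.
    + by move=> t w _; rewrite lee_fin addr_ge0.
    under eq_bigr => t _.
      under eq_integral do rewrite EFinD.
      rewrite ge0_integralD//; last 4 first.
      + by move=> w _; rewrite lee_fin.
      + exact/measurable_EFinP.
      + by move=> w _; rewrite lee_fin.
      + exact/measurable_EFinP.
      rewrite !iE -EFinD; over.
    by rewrite sumEFin sumr_const card_ord lee_fin -[leLHS]mulr_natr lexx.
apply: filterS (ae_foralln key) => w Hw e e0.
pose k := Num.truncn e^-1.
have ke : k.+1%:R^-1 <= e.
  by rewrite invf_ple ?posrE// ltW// truncnS_gt.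
apply: filterS (Hw k) => n; apply: contraTT; rewrite -ltNge -leNgt => H.
apply: exp_mart_ge_noise; first by rewrite invr_gt0.
by apply: le_lt_trans H; rewrite -!mulrA ler_wpM2r// mulr_ge0.
Qed.

End noise.

(** * The allocation problem *)

Section complexity.
Context (R : realType) (K : nat) (mu : 'I_K.+2 -> R) (sigma : R).
Hypotheses (sigma_gt0 : 0 < sigma)
  (mu_decr : forall i j : 'I_K.+2, (i < j)%N -> mu j < mu i).
Local Notation arm := 'I_K.+2.
Local Notation arm2 := (lift ord0 ord0 : arm).
Implicit Types (i j : arm) (s b : R).

Let gap j := (mu j - mu ord0) ^+ 2.

Let gap_gt0 j : j != ord0 -> 0 < gap j.
Proof.
move=> j0; rewrite /gap exprn_even_gt0//= subr_eq0 lt_eqF// mu_decr//.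
by rewrite lt0n.
Qed.

(** Arm 2 is the closest competitor, so the single condition [1 < s * gap arm2] makes every
    denominator in [rem] positive. *)
Let gap_arm2_le j : j != ord0 -> gap arm2 <= gap j.
Proof.
move=> j0; have [->//|j2] := eqVneq j arm2.
have j_gt0 : (0 < j)%N by rewrite lt0n.
have j_gt1 : (1 < j)%N by rewrite ltn_neqAle j_gt0 andbT eq_sym.
have mu2 : mu arm2 <= mu ord0 by rewrite ltW// mu_decr.
have mu2j : mu j <= mu arm2 by rewrite ltW// mu_decr.
rewrite /gap -[leLHS]sqrrN -[leRHS]sqrrN !opprB lerXn2r ?nnegrE ?subr_ge0//.
  by rewrite (le_trans mu2j).
by rewrite lerB.
Qed.

Let arm2_neq0 : arm2 != ord0. Proof. by []. Qed.

(* With [s = b / c], where [c] is the common value of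
   [gap j / (1 / w j + 1 / b)], the weights are [w j = b / (s * gap j - 1)],
   so that [rem s = 1 / b - 1] and [c = 1 / (s * (1 + rem s))]. *)
Let rem s : R := \sum_(j | j != ord0) (s * gap j - 1)^-1.

Let sgap_gt0 s j : 1 < s * gap arm2 -> j != ord0 -> 0 < s * gap j - 1.
Proof.
move=> s1 j0; rewrite subr_gt0 (lt_le_trans s1)// ler_wpM2l ?gap_arm2_le//.
by rewrite ltW// -(pmulr_lgt0 _ (gap_gt0 arm2_neq0)) (lt_trans ltr01).
Qed.

Let s_gt0 s : 1 < s * gap arm2 -> 0 < s.
Proof.
by move=> s1; rewrite -(pmulr_lgt0 _ (gap_gt0 arm2_neq0)) (lt_trans ltr01).
Qed.

Let rem_gt0 s : 1 < s * gap arm2 -> 0 < rem s.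
Proof.
move=> s1; rewrite /rem (bigD1 arm2)//= ltr_pwDl ?invr_gt0 ?sgap_gt0//.
by apply: sumr_ge0 => j /andP[j0 _]; rewrite invr_ge0 ltW// sgap_gt0.
Qed.

Let rem_decr s t : 1 < s * gap arm2 -> s < t -> rem t < rem s.
Proof.
move=> s1 st.
have lt j : j != ord0 -> (t * gap j - 1)^-1 < (s * gap j - 1)^-1.
  move=> j0; have st' : s * gap j - 1 < t * gap j - 1.
    by rewrite ltrD2r ltr_pM2r// gap_gt0.
  have s0 := sgap_gt0 s1 j0.
  by rewrite ltf_pV2 ?posrE// (lt_trans s0).
rewrite /rem (bigD1 arm2)//= [ltRHS](bigD1 arm2)//= ltr_leD ?lt//.
by apply: ler_sum => j /andP[j0 _]; rewrite ltW// lt.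
Qed.

Let rem_inj s t :
  1 < s * gap arm2 -> 1 < t * gap arm2 -> rem s = rem t -> s = t.
Proof.
move=> s1 t1 st; case: (ltgtP s t) => // /rem_decr H.
  by have := H s1; rewrite st ltxx.
by have := H t1; rewrite st ltxx.
Qed.

Let rem_continuous s : 1 < s * gap arm2 -> {for s, continuous rem}.
Proof.
move=> s1; rewrite /rem.
apply: cvg_big => [|j j0 /=]; first exact: add_continuous.
apply: cvgV; first by rewrite gt_eqF// sgap_gt0.
apply: cvgB; last exact: cvg_cst.
by apply: cvgM; [exact: cvg_id|exact: cvg_cst].
Qed.

(** Intermediate value theorem. At [lo] the term of arm 2 alone equals [r]; at [hi] each of the
    [K.+1] terms is at most [r / K.+1]. *)
Let rem_solvable (r : R) : 0 < r -> exists2 s, 1 < s * gap arm2 & rem s = r.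
Proof.
move=> r0; have g0 := gap_gt0 arm2_neq0.
have rV0 : 0 < r^-1 by rewrite invr_gt0.
pose k : R := K.+1%:R.
have k1 : 1 <= k by rewrite /k ler1n.
pose lo := (1 + r^-1) / gap arm2; pose hi := (1 + k / r) / gap arm2.
have lohi : lo <= hi.
  by rewrite /lo /hi ler_pM2r ?invr_gt0// lerD2l ler_peMl// ltW.
have lo1 : lo * gap arm2 = 1 + r^-1 by rewrite /lo divfK// gt_eqF.
have hi1 : hi * gap arm2 = 1 + k / r by rewrite /hi divfK// gt_eqF.
have ge1 s : lo <= s -> 1 < s * gap arm2.
  move=> los; apply: (@lt_le_trans _ _ (lo * gap arm2)).
    by rewrite lo1 ltrDl.
  by rewrite ler_pM2r.
have [||s] := @IVT _ rem lo hi r lohi.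
- apply: continuous_in_subspaceT => s; rewrite inE /= in_itv/= => /andP[los _].
  exact/rem_continuous/ge1.
- rewrite ge_min le_max; apply/andP; split; apply/orP; [right|left].
    rewrite /rem.
    apply: (@le_trans _ _ (\sum_(j : arm | j != ord0) (k / r)^-1)).
      apply: ler_sum => j j0; rewrite lef_pV2 ?posrE ?sgap_gt0 ?ge1//.
        rewrite lerBrDl -hi1 ler_wpM2l ?gap_arm2_le//.
        by rewrite (le_trans _ lohi)// divr_ge0 ?addr_ge0// ltW.
      by rewrite divr_gt0// (lt_le_trans _ k1).
    rewrite sumr_const (_ : #|_| = K.+1); last first.
      by rewrite (cardC1 (ord0 : arm)) card_ord.
    rewrite invf_div -[leLHS]mulr_natr -/k divfK//.
    by rewrite gt_eqF// (lt_le_trans _ k1).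
  rewrite /rem (bigD1 arm2)//= lo1 [1 + _]addrC addrK invrK lerDl.
  by apply: sumr_ge0 => j /andP[j0 _]; rewrite invr_ge0 ltW// sgap_gt0// ge1.
- by rewrite in_itv/= => /andP[los _] remE; exists s => //; exact: ge1.
Qed.

Let weights_param b s : 0 < b < 1 -> 1 < s * gap arm2 -> rem s = b^-1 - 1 ->
  is_weights mu b (fun j => if j == ord0 then b else b / (s * gap j - 1)).
Proof.
move=> /andP[b0 b1] s1 remE.
have valE j : j != ord0 ->
    gap j / ((b / (s * gap j - 1))^-1 + b^-1) = b / s.
  move=> j0; have := sgap_gt0 s1 j0; have := gap_gt0 j0; have := s_gt0 s1.
  move=> ? ? ?; field; rewrite ?gt_eqF//=.
  by rewrite addr_gt0.
split=> //.
- by move=> j j0; rewrite (negPf j0) divr_gt0// sgap_gt0.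
- under eq_bigr => j j0 do rewrite (negPf j0).
  by rewrite -mulr_sumr -/(rem s) remE mulrBr mulr1 divff ?gt_eqF.
- by move=> i j i0 j0; rewrite (negPf i0) (negPf j0) !valE.
Qed.

Lemma weightsP b : 0 < b < 1 -> is_weights mu b (weights mu b).
Proof.
move=> b01; have /andP[b0 b1] := b01; apply: xgetPex.
have [|s s1 remE] := @rem_solvable (b^-1 - 1).
  by rewrite subr_gt0 invf_gt1.
by eexists; exact: weights_param remE.
Qed.

(** Converse of [weights_param]. Together with [rem_inj] it amounts to uniqueness of the weights,
    and it allows computing with the chosen vector [weights mu b]. *)
Let param_weights b w : 0 < b < 1 -> is_weights mu b w ->
  exists s, [/\ 1 < s * gap arm2, rem s = b^-1 - 1 &
    forall j, j != ord0 -> w j = b / (s * gap j - 1)].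
Proof.
move=> /andP[b0 b1] [w0 wpos wsum weq].
pose c := gap arm2 / ((w arm2)^-1 + b^-1).
have w2 := wpos _ arm2_neq0.
have c0 : 0 < c by rewrite divr_gt0 ?gap_gt0// addr_gt0 ?invr_gt0.
have sE j : j != ord0 -> b / c * gap j - 1 = b / w j.
  move=> j0; have wj := wpos _ j0.
  have -> : c = gap j / ((w j)^-1 + b^-1) by rewrite /c /gap (weq _ j).
  have := gap_gt0 j0 => gj; field; rewrite ?gt_eqF//=.
  by rewrite addr_gt0.
have wE j : j != ord0 -> w j = b / (b / c * gap j - 1).
  by move=> j0; rewrite sE// invf_div mulrC divfK ?gt_eqF.
exists (b / c); split=> //.
  by rewrite -subr_gt0 sE// divr_gt0.
rewrite /rem; under eq_bigr => j j0 do rewrite sE// invf_div.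
by rewrite -mulr_suml wsum mulrBl mul1r divff ?gt_eqF.
Qed.

Let GammaE b s : 0 < b < 1 -> 1 < s * gap arm2 -> rem s = b^-1 - 1 ->
  Gamma mu sigma b = (2 * sigma ^+ 2 * (s * (1 + rem s)))^-1.
Proof.
move=> b01 s1 remE; have /andP[b0 b1] := b01.
have [t [t1 remt wE]] := param_weights b01 (weightsP b01).
have -> : s = t by apply: rem_inj => //; rewrite remE remt.
rewrite /Gamma wE// remt -/(gap arm2) (_ : 1 + (b^-1 - 1) = b^-1); last by ring.
have := sgap_gt0 t1 arm2_neq0; have := gap_gt0 arm2_neq0; have := s_gt0 t1.
move=> ? ? ?; field; rewrite ?gt_eqF//=.
by rewrite addr_gt0.
Qed.

(** By [GammaE], maximizing [Gamma] over [b] in (0, 1) is minimizing [h] over [s > 1 / gap arm2]. *)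
Let h s := s * (1 + rem s).

(** [h] is large at both ends: [h t > t], and near [1 / gap arm2] the term of arm 2 in [rem] blows
    up. The minimum over the compact interval [[lo, h s0]] is therefore global. *)
Let h_min : exists2 s, 1 < s * gap arm2 &
  forall t, 1 < t * gap arm2 -> h s <= h t.
Proof.
have g0 := gap_gt0 arm2_neq0.
pose s0 := 2 / gap arm2.
have s01 : s0 * gap arm2 = 2 by rewrite /s0 divfK// gt_eqF.
have s0_1 : 1 < s0 * gap arm2 by rewrite s01; lra.
have h_ge t : 1 < t * gap arm2 -> t < h t.
  by move=> t1; rewrite /h ltr_pMr ?s_gt0// ltrDl rem_gt0.
have h0 : 0 < h s0 by rewrite (lt_trans _ (h_ge _ s0_1))// s_gt0.
(* Chosen so that [t * gap arm2 - 1 < c] forces [rem t > gap arm2 * h s0], whence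
   [h t > t * rem t > h s0]. *)
pose c := (gap arm2 * h s0)^-1.
have c0 : 0 < c by rewrite invr_gt0 mulr_gt0.
pose lo := (1 + c) / gap arm2.
have lo1 : lo * gap arm2 = 1 + c by rewrite /lo divfK// gt_eqF.
have ge1 s : lo <= s -> 1 < s * gap arm2.
  move=> los; apply: (@lt_le_trans _ _ (lo * gap arm2)).
    by rewrite lo1 ltrDl.
  by rewrite ler_pM2r.
have small t : 1 < t * gap arm2 -> t < lo -> h s0 < h t.
  move=> t1 tlo; have tg : t * gap arm2 - 1 < c.
    by rewrite ltrBlDl -lo1 ltr_pM2r.
  have tg0 := sgap_gt0 t1 arm2_neq0.
  have remt : (t * gap arm2 - 1)^-1 <= rem t.
    rewrite /rem (bigD1 arm2)//= lerDl; apply: sumr_ge0 => j /andP[j0 _].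
    by rewrite invr_ge0 ltW// sgap_gt0.
  have tgV : (gap arm2)^-1 < t by rewrite -[_^-1]mul1r ltr_pdivrMr.
  have cV : gap arm2 * h s0 < rem t.
    by rewrite (lt_le_trans _ remt)// -[ltLHS]invrK ltf_pV2 ?posrE.
  apply: (@lt_trans _ _ (t * rem t)); last first.
    by rewrite ltr_pM2l ?s_gt0// ltrDr.
  apply: (@lt_trans _ _ ((gap arm2)^-1 * rem t)); last first.
    by rewrite ltr_pM2r ?rem_gt0.
  by rewrite mulrC ltr_pdivlMr// mulrC.
have losn : lo <= s0.
  by rewrite leNgt; apply/negP => /(small _ s0_1); rewrite ltxx.
have s0h : s0 <= h s0 by rewrite ltW// h_ge.
have [|s] := @EVT_min _ h lo (h s0) (le_trans losn s0h).
  apply: continuous_in_subspaceT => s; rewrite inE /= in_itv/= => /andP[los _].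
  apply: cvgM; first exact: cvg_id.
  by apply: cvgD; [exact: cvg_cst|exact/rem_continuous/ge1].
rewrite in_itv/= => /andP[los _] smin; exists s; first exact: ge1.
have ss0 : h s <= h s0 by apply: smin; rewrite in_itv/= losn.
move=> t t1; have [tlo|lot] := ltP t lo.
  by rewrite (le_trans ss0)// ltW// small.
have [ht|th] := ltP (h s0) t.
  by rewrite (le_trans ss0)// (le_trans (ltW ht))// ltW// h_ge.
by apply: smin; rewrite in_itv/= lot.
Qed.

(** The maximizer is [1 / (1 + rem s)] at the minimizer [s] of [h], by inverting
    [rem s = 1 / b - 1]. *)
Lemma beta_starP : is_argmax_Gamma mu sigma (beta_star mu sigma).
Proof.
apply: xgetPex; have [s s1 smin] := h_min.
have r0 := rem_gt0 s1.
have d0 : 0 < 1 + rem s by rewrite addr_gt0.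
have b01 : 0 < (1 + rem s)^-1 < 1.
  by rewrite invr_gt0 d0 invf_lt1// ltrDl.
have s2 : 0 < 2 * sigma ^+ 2 by rewrite mulr_gt0// exprn_gt0.
exists (1 + rem s)^-1; split=> // b b'01; have /andP[b0 b1] := b'01.
have [|t t1 remE] := @rem_solvable (b^-1 - 1).
  by rewrite subr_gt0 invf_gt1.
rewrite (GammaE b'01 t1)// (GammaE b01 s1); last by rewrite invrK addrC addKr.
have hpos u : 1 < u * gap arm2 -> 0 < u * (1 + rem u).
  by move=> u1; rewrite mulr_gt0 ?(s_gt0 u1)// ltr_wpDl// rem_gt0.
rewrite lef_pV2 ?posrE; last 2 first.
- by rewrite mulr_gt0 ?hpos.
- by rewrite mulr_gt0 ?hpos.
by rewrite ler_pM2l//; exact: smin.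
Qed.

Lemma Gamma_ge0 b : 0 < b < 1 -> 0 <= Gamma mu sigma b.
Proof.
move=> b01; have [_ /(_ _ arm2_neq0) w0 _ _] := weightsP b01.
have /andP[b0 _] := b01.
have s2 : 0 <= 2 * sigma ^+ 2 by rewrite mulr_ge0 ?sqr_ge0.
by rewrite /Gamma divr_ge0 ?sqr_ge0// mulr_ge0// addr_ge0// invr_ge0 ltW.
Qed.

Lemma Gamma_arm b j : 0 < b < 1 -> j != ord0 ->
  Gamma mu sigma b = (mu j - mu ord0) ^+ 2 /
    (2 * sigma ^+ 2 * ((weights mu b j)^-1 + b^-1)).
Proof.
move=> b01 j0; have [_ _ _ /(_ _ _ arm2_neq0 j0) weq] := weightsP b01.
rewrite /Gamma [X in _ / X = _]mulrC [X in _ = _ / X]mulrC !invfM !mulrA.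
by rewrite weq.
Qed.

(** The weighted mean minimizes the quadratic cost [b * (x - mu ord0) ^+ 2 + w * (x - mu j) ^+ 2],
    where [w = weights mu b j]; the minimum is the squared gap over [1 / w + 1 / b]. *)
Let x_opt b j := (b * mu ord0 + weights mu b j * mu j) / (b + weights mu b j).

Let x_opt_cost b j : 0 < b < 1 -> j != ord0 ->
  b * (x_opt b j - mu ord0) ^+ 2 + weights mu b j * (x_opt b j - mu j) ^+ 2 =
  2 * sigma ^+ 2 * Gamma mu sigma b.
Proof.
move=> b01 j0; rewrite (Gamma_arm b01 j0) /x_opt.
have [_ /(_ _ j0) w0 _ _] := weightsP b01; have /andP[b0 _] := b01.
have wb : 0 < b + weights mu b j by rewrite addr_gt0.
by field; rewrite !gt_eqF// addrC.
Qed.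

Let x_opt_itv b j : 0 < b < 1 -> j != ord0 -> mu j <= x_opt b j <= mu ord0.
Proof.
move=> b01 j0; have [_ /(_ _ j0) w0 _ _] := weightsP b01.
have /andP[b0 _] := b01.
have wb : 0 < b + weights mu b j by rewrite addr_gt0.
have mj : mu j <= mu ord0 by rewrite ltW// mu_decr// lt0n.
have := ler_wpM2l (ltW b0) mj; have := ler_wpM2l (ltW w0) mj.
rewrite /x_opt ler_pdivlMr// ler_pdivrMr// => ? ?; apply/andP; split; lra.
Qed.

(** Pigeonhole: some arm [j] is sampled at most [e] more than its weight, and so is arm 1. The cost
    is linear in the proportions, so at [x_opt b j] it exceeds its optimal value by at most [e]
    times two squares. *)
Lemma exists_cheap_arm b (p : arm -> R) :
  0 < b < 1 -> (forall i, 0 <= p i) -> \sum_i p i <= 1 ->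
  exists j x, [/\ j != ord0, mu j <= x <= mu ord0 &
    p ord0 * (x - mu ord0) ^+ 2 + p j * (x - mu j) ^+ 2 <=
    2 * sigma ^+ 2 * Gamma mu sigma b +
      `|b - p ord0| * (2 * (mu ord0 - mu ord_max) ^+ 2)].
Proof.
move=> b01 p0 psum; have [_ wpos wsum _] := weightsP b01.
set e := `|b - p ord0|.
(* Otherwise the other arms would take more than [1 - b + e] in total, while arm 1 has at least
   [b - e]. *)
have [j j0 pj] : exists2 j, j != ord0 & p j <= weights mu b j + e.
  apply: contrapT => /forall2NP H.
  have wp j : j != ord0 -> weights mu b j + e < p j.
    by move=> j0; have [//|/negP] := H j; rewrite -ltNge.
  have : \sum_(j | j != ord0) (weights mu b j + e) < \sum_(j | j != ord0) p j.
    rewrite (bigD1 arm2)//= [ltRHS](bigD1 arm2)//= ltr_leD ?wp//.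
    by apply: ler_sum => j /andP[j0 _]; rewrite ltW// wp.
  rewrite big_split /= wsum; apply/negP; rewrite -leNgt.
  move: psum; rewrite (bigD1 ord0)//= => psum.
  have e0 : 0 <= e by rewrite normr_ge0.
  have e1 : e <= \sum_(j : arm | j != ord0) e.
    by rewrite (bigD1 arm2)//= lerDl sumr_ge0.
  have : b - p ord0 <= e by exact: ler_norm.
  by lra.
have p0b : p ord0 <= b + e.
  by rewrite -lerBlDl /e distrC ler_norm.
have /andP[xj x0] := x_opt_itv b01 j0.
exists j, (x_opt b j); split=> //; first by rewrite xj.
have mjm : mu ord_max <= mu j.
  have [->//|jm] := eqVneq j ord_max.
  by rewrite ltW// mu_decr//= ltn_neqAle -ltnS ltn_ord andbT.
set x := x_opt b j in xj x0 *.
(* The points [x], [mu j] and [mu ord0] all lie in an interval of length [D]. *)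
pose D := mu ord0 - mu ord_max.
have sq (y : R) : `|y| <= D -> y ^+ 2 <= D ^+ 2.
  move=> yD; rewrite -real_normK ?num_real// lerXn2r ?nnegrE//.
  by rewrite (le_trans _ yD).
have s0 : (x - mu ord0) ^+ 2 <= D ^+ 2 by apply: sq; rewrite ler_norml /D; lra.
have sj : (x - mu j) ^+ 2 <= D ^+ 2 by apply: sq; rewrite ler_norml /D; lra.
have := x_opt_cost b01 j0; rewrite -/x => <-.
apply: (le_trans (lerD (ler_wpM2r (sqr_ge0 _) p0b) (ler_wpM2r (sqr_ge0 _) pj))).
have := ler_wpM2l (normr_ge0 _ : 0 <= e) s0.
have := ler_wpM2l (normr_ge0 _ : 0 <= e) sj.
rewrite -/D; lra.
Qed.

(** With [b = p ord0] the deviation term vanishes and [Gamma b] is at most [Gamma_star]. If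
    [p ord0 = 0], the point [x = mu arm2] costs nothing. *)
Lemma exists_cheap_arm_star (p : arm -> R) :
  (forall i, 0 <= p i) -> p ord0 < 1 -> \sum_i p i <= 1 ->
  exists j x, [/\ j != ord0, mu j <= x <= mu ord0 &
    p ord0 * (x - mu ord0) ^+ 2 + p j * (x - mu j) ^+ 2 <=
    2 * sigma ^+ 2 * Gamma_star mu sigma].
Proof.
move=> p0 p1 psum; have [bs01 bsmax] := beta_starP.
have [p00|] := eqVneq (p ord0) 0; last first.
  rewrite neq_lt ltNge p0/= => p00.
  have p01 : 0 < p ord0 < 1 by rewrite p00.
  have [j [x [j0 xj le]]] := exists_cheap_arm p01 p0 psum.
  exists j, x; split=> //; apply: (le_trans le).
  rewrite subrr normr0 mul0r addr0 ler_pM2l ?bsmax//.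
  by rewrite mulr_gt0// exprn_gt0.
exists arm2, (mu arm2); split=> //.
  by rewrite lexx ltW// mu_decr.
rewrite p00 mul0r subrr expr0n mulr0 addr0 mulr_ge0 ?Gamma_ge0//.
by rewrite mulr_ge0 ?sqr_ge0.
Qed.

End complexity.

(** * Posterior error along a path *)

Section path.
Context (R : realType) (K : nat) d (Omega : measurableType d)
  (P : probability Omega R) (mu m0 s0 : 'I_K.+2 -> R) (sigma : R)
  (Y : nat -> 'I_K.+2 -> {RV P >-> R}) (I : nat -> Omega -> 'I_K.+2)
  (w : Omega).
Hypotheses (sigma_gt0 : 0 < sigma) (s0_gt0 : forall i, 0 < s0 i).
Local Notation arm := 'I_K.+2.
Implicit Types (i j : arm) (n : nat).

Definition post_mean n i := (posterior_mv sigma m0 s0 Y I n i w).1.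
Definition post_var n i := (posterior_mv sigma m0 s0 Y I n i w).2.
Local Notation m := post_mean.
Local Notation v := post_var.
Local Notation S n i := (noise mu Y I n i w).
Local Notation T n i := (pulls I n i w).
Definition proportion n i : R := (T n i)%:R / n.+1%:R.
Local Notation p := proportion.

Let N_gt0 n : 0 < n.+1%:R :> R. Proof. by rewrite ltr0n. Qed.
Let s2_gt0 : 0 < sigma ^+ 2. Proof. by rewrite exprn_gt0. Qed.
Let s02_gt0 i : 0 < s0 i ^+ 2. Proof. by rewrite exprn_gt0. Qed.

Lemma post_var_inv n i : (v n i)^-1 = s0 i ^- 2 + (T n i)%:R / sigma ^+ 2.
Proof.
rewrite /post_var; elim: n => [|n IHn] /=.
  by rewrite /pulls big_ord0 mul0r addr0.
rewrite /pulls big_ord_recr /= -/(pulls I n i w) natrD mulrDl addrA -IHn.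
case: (posterior_mv _ _ _ _ _ _ _ _) => m v /=.
by case: eqP => _ /=; rewrite ?invrK ?mul1r// mul0r addr0.
Qed.

Lemma post_var_gt0 n i : 0 < v n i.
Proof.
rewrite -invr_gt0 post_var_inv ltr_pwDl ?invr_gt0//.
by rewrite divr_ge0// ltW.
Qed.

(** Precision times posterior mean is linear in the data: each observation adds [Y / sigma ^+ 2] to
    it, starting from the prior's contribution. *)
Lemma post_mean_noise n i : (v n i)^-1 * (m n i - mu i) =
  s0 i ^- 2 * (m0 i - mu i) + S n i / sigma ^+ 2.
Proof.
rewrite mulrBr post_var_inv.
suff -> : (s0 i ^- 2 + (T n i)%:R / sigma ^+ 2) * m n i =
    s0 i ^- 2 * m0 i + (S n i + (T n i)%:R * mu i) / sigma ^+ 2.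
  by field; rewrite !gt_eqF.
rewrite -post_var_inv.
elim: n => [|n IHn].
  rewrite /post_mean /post_var /noise /pulls /= !big_ord0.
  by rewrite mul0r addr0 mul0r addr0.
have vn := post_var_gt0 n i.
rewrite /noise /pulls !big_ord_recr /= -/(pulls I n i w) -/(noise mu Y I n i w).
move: IHn vn; rewrite /post_mean /post_var /=.
case: (posterior_mv _ _ _ _ _ _ _ _) => m' v' /= IHn vn.
case: eqP => _ /=; last by rewrite addn0 mul0r addr0.
rewrite invrK mulrCA mulfV ?mulr1; last first.
  by rewrite gt_eqF// addr_gt0// invr_gt0.
by rewrite IHn addn1 mul1r -[(_.+1)%:R]natr1; field; rewrite !gt_eqF.
Qed.

Lemma proportion_ge0 n i : 0 <= p n i.
Proof. by rewrite divr_ge0. Qed.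

Lemma sum_pulls n : (\sum_i T n i)%N = n.
Proof.
rewrite /pulls exchange_big /= -[RHS]card_ord -sum1_card.
apply: eq_bigr => l _; rewrite (bigD1 (I l w))//= eqxx big1 ?addn0// => i.
by rewrite eq_sym => /negPf ->.
Qed.

Lemma sum_proportion n : \sum_i p n i <= 1.
Proof.
by rewrite -mulr_suml -natr_sum sum_pulls ler_pdivrMr// mul1r ler_nat.
Qed.

(** Normalizing by [n.+1] makes this strict even when a single arm gets all pulls, so a nonzero
    proportion of arm 1 can serve as [b] in (0, 1). *)
Lemma proportion_lt1 n i : p n i < 1.
Proof. by rewrite ltr_pdivrMr// mul1r ltr_nat ltnS pulls_le. Qed.

(** Squared error in units of posterior standard deviation, per round. When it vanishes, [m n i] may
    be replaced by [mu i] on the exponential scale, even for an arm whose posterior mean does not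
    converge to [mu i]. *)
Definition mean_error n i := (m n i - mu i) ^+ 2 / (v n i * n.+1%:R).

Lemma mean_error_ge0 n i : 0 <= mean_error n i.
Proof. by rewrite divr_ge0 ?sqr_ge0// mulr_ge0// ltW// post_var_gt0. Qed.

Hypothesis noise_small : forall i (e : R), 0 < e -> \forall n \near \oo,
  S n i ^+ 2 <= e * n.+1%:R * (T n i).+1%:R.

Let cvg_cst_over_n (c : R) : c / n.+1%:R @[n --> \oo] --> 0.
Proof.
rewrite -[X in _ --> X](mulr0 c); apply: cvgM; first exact: cvg_cst.
exact: cvg_harmonic.
Qed.

(** In precision form, the numerator is at most a constant plus a multiple of [e * n.+1 * T.+1], and
    the denominator is at least a multiple of [n.+1 * T.+1]: the number of pulls cancels. *)
Lemma cvg_mean_error i : mean_error n i @[n --> \oo] --> 0.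
Proof.
(* With this [k] the precision is at least [k * T.+1]; the prior accounts for the extra unit, which
   covers arms never pulled. *)
pose k := Num.min (s0 i ^- 2) (sigma ^- 2).
have k0 : 0 < k by rewrite lt_min !invr_gt0 s02_gt0 s2_gt0.
pose A := (s0 i ^- 2 * (m0 i - mu i)) ^+ 2.
have bound e n : 0 < e -> S n i ^+ 2 <= e * n.+1%:R * (T n i).+1%:R ->
    mean_error n i <= 2 / k * A / n.+1%:R + 2 / k / sigma ^+ 4 * e.
  move=> e0 Se; have vn := post_var_gt0 n i.
  have -> : mean_error n i =
      ((v n i)^-1 * (m n i - mu i)) ^+ 2 / ((v n i)^-1 * n.+1%:R).
    by rewrite /mean_error; field; rewrite !gt_eqF.
  have T1 : 1 <= (T n i).+1%:R :> R by rewrite ler1n.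
  have kv : k * (T n i).+1%:R <= (v n i)^-1.
    rewrite post_var_inv -natr1 mulrDr mulr1 addrC lerD//.
      by rewrite ge_min lexx.
    by rewrite mulrC ler_wpM2l// ge_min lexx orbT.
  rewrite ler_pdivrMr ?mulr_gt0 ?invr_gt0// post_mean_noise.
  set a := s0 i ^- 2 * _; set b := S n i / _.
  have ab : (a + b) ^+ 2 <= 2 * (a ^+ 2 + b ^+ 2).
    by have := sqr_ge0 (a - b); rewrite sqrrB sqrrD; lra.
  apply: (le_trans ab).
  set E := 2 / k * A / n.+1%:R + 2 / k / sigma ^+ 4 * e.
  have A0 : 0 <= A by exact: sqr_ge0.
  have E0 : 0 <= E.
    have k20 : 0 <= 2 / k by rewrite divr_ge0// ltW.
    rewrite /E; apply: addr_ge0; first by rewrite divr_ge0// mulr_ge0.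
    by rewrite mulr_ge0 ?(ltW e0)// divr_ge0// exprn_ge0// ltW.
  have kvN : k * (T n i).+1%:R * n.+1%:R <= (v n i)^-1 * n.+1%:R.
    by rewrite ler_pM2r.
  apply: le_trans (ler_wpM2l E0 kvN).
  have -> : E * (k * (T n i).+1%:R * n.+1%:R) = 2 * (A * (T n i).+1%:R +
      e * n.+1%:R * (T n i).+1%:R / sigma ^+ 4).
    by rewrite /E; field; rewrite !gt_eqF.
  rewrite ler_pM2l// lerD//.
    by rewrite -[leLHS]/A ler_peMr.
  by rewrite /b expr_div_n -exprM ler_pM2r// invr_gt0 exprn_gt0.
have sk : 0 < 2 / k / sigma ^+ 4 by rewrite !divr_gt0// exprn_gt0.
apply/cvgrPdist_le => eps eps0.
pose e := eps / 2 / (2 / k / sigma ^+ 4).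
have e0 : 0 < e by rewrite divr_gt0// divr_gt0.
have Hc := cvg_cst_over_n (2 / k * A).
have eps20 : 0 < eps / 2 by rewrite divr_gt0.
move/cvgrPdist_le : Hc => /(_ _ eps20) Hc.
apply: filterS2 (noise_small i e0) Hc => n Se; rewrite !sub0r !normrN => Hn.
rewrite ger0_norm ?mean_error_ge0//.
apply: (le_trans (bound _ _ e0 Se)).
rewrite [X in _ + X](_ : _ = eps / 2); last first.
  by rewrite /e mulrC divfK// gt_eqF.
by rewrite [leRHS]splitr lerD2r; exact: le_trans (ler_norm _) Hn.
Qed.

Local Notation alphan n := (alpha sigma m0 s0 Y I n ord0 w).
Local Notation rt n := (rate sigma m0 s0 Y I n w).

Let alphaE n : alphan n = fine ((tuple_prob (fun i =>
    normal_prob (m n i) (Num.sqrt (v n i))) :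
  probability ((K.+2).-tuple (measurableTypeR R)) R)
  [set theta | forall j, j != ord0 -> tnth theta j < tnth theta ord0]).
Proof.
rewrite /alpha /posterior; set F := (F in tuple_prob F).
suff -> : F = (fun i => normal_prob (m n i) (Num.sqrt (v n i))) by [].
apply/funext => i; rewrite /F /post_mean /post_var.
by case: (posterior_mv _ _ _ _ _ _ _ _).
Qed.

Let sd_gt0 n i : 0 < Num.sqrt (v n i).
Proof. by rewrite sqrtr_gt0 post_var_gt0. Qed.

Let tail n i (x : R) := (`|x - m n i| / Num.sqrt (v n i) + 1) ^+ 2.

Let c : R := (Num.sqrt (2 * pi))^-1.

Let c_gt0 : 0 < c. Proof. by rewrite invr_gt0 sqrtr_gt0 mulr_gt0// pi_gt0. Qed.

Let error_ge n j x : j != ord0 ->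
  expR (- (tail n ord0 x + tail n j x) / 2 + 2 * ln c) <= 1 - alphan n.
Proof.
move=> j0; rewrite alphaE.
apply: le_trans (one_sub_best_ge (m n) (sd_gt0 n) x j0).
have : c = expR (ln c) by rewrite lnK.
rewrite -/c; set L := ln c => ->; rewrite -!expRD ler_expR /tail.
by rewrite le_eqVlt; apply/orP; left; apply/eqP; field; rewrite !gt_eqF.
Qed.

(** Positivity makes [ln (1 - alpha)] a genuine logarithm, not its default value; any arm and
    threshold in [error_ge] would do. *)
Let error_gt0 n : 0 < 1 - alphan n.
Proof.
exact: lt_le_trans (expR_gt0 _) (@error_ge n (lift ord0 ord0) 0 isT).
Qed.

Let rate_tail n j x : j != ord0 ->
  rt n <= (tail n ord0 x / n.+1%:R + tail n j x / n.+1%:R) / 2 -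
    2 * ln c / n.+1%:R.
Proof.
move=> j0; rewrite /rate.
have := error_ge n x j0; rewrite -ler_ln ?posrE ?expR_gt0// expRK => H.
have -> : (tail n ord0 x / n.+1%:R + tail n j x / n.+1%:R) / 2 -
    2 * ln c / n.+1%:R =
    - (n.+1%:R^-1 * (- (tail n ord0 x + tail n j x) / 2 + 2 * ln c)) by ring.
by rewrite mulNr lerN2 ler_pM2l// invr_gt0.
Qed.

(** Young's inequality with parameter [e] separates [a], the distance of [x] from the true mean,
    which gives the term linear in the proportion, from [b + 1], which gives an error vanishing with
    [mean_error]. *)
Let tail_le n i x (e D : R) : 0 < e -> (x - mu i) ^+ 2 <= D ->
  tail n i x / n.+1%:R <= (1 + e) / sigma ^+ 2 * (p n i * (x - mu i) ^+ 2) +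
    ((1 + e) * (s0 i ^- 2 * D / n.+1%:R) +
     (1 + e^-1) * (2 * (mean_error n i + n.+1%:R^-1))).
Proof.
move=> e0 xD; set s := Num.sqrt (v n i).
have s_gt0 : 0 < s by exact: sd_gt0.
have sv : s ^+ 2 = v n i by rewrite sqr_sqrtr// ltW// post_var_gt0.
pose a := `|x - mu i| / s; pose b := `|mu i - m n i| / s.
have a0 : 0 <= a by rewrite divr_ge0// ltW.
have b0 : 0 <= b by rewrite divr_ge0// ltW.
have tab : tail n i x <= (a + (b + 1)) ^+ 2.
  rewrite lerXn2r ?nnegrE ?addr_ge0// ?divr_ge0// ?(ltW s_gt0)//.
  rewrite addrA lerD2r -mulrDl ler_pM2r ?invr_gt0//.
  by rewrite (le_trans _ (ler_normD _ _))// subrKA.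
have young : (a + (b + 1)) ^+ 2 <= (1 + e) * a ^+ 2 + (1 + e^-1) * (b + 1) ^+ 2.
  have : 0 <= (e * a - (b + 1)) ^+ 2 / e by rewrite divr_ge0 ?sqr_ge0 ?ltW.
  have -> : (e * a - (b + 1)) ^+ 2 / e =
      e * a ^+ 2 + e^-1 * (b + 1) ^+ 2 - 2 * (a * (b + 1)).
    by field; rewrite gt_eqF.
  by rewrite sqrrD; lra.
have b2 : (b + 1) ^+ 2 <= 2 * (b ^+ 2 + 1).
  by have := sqr_ge0 (b - 1); rewrite sqrrB sqrrD; lra.
have a2E : a ^+ 2 = (x - mu i) ^+ 2 / v n i.
  by rewrite /a expr_div_n real_normK ?num_real// sv.
have b2E : b ^+ 2 / n.+1%:R = mean_error n i.
  rewrite /b expr_div_n real_normK ?num_real// sv -[mu i - _]opprB sqrrN.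
  by rewrite /mean_error invfM mulrA.
have a2N : a ^+ 2 / n.+1%:R <=
    p n i * (x - mu i) ^+ 2 / sigma ^+ 2 + s0 i ^- 2 * D / n.+1%:R.
  rewrite a2E post_var_inv /proportion.
  have -> : (x - mu i) ^+ 2 * (s0 i ^- 2 + (T n i)%:R / sigma ^+ 2) / n.+1%:R =
      (T n i)%:R / n.+1%:R * (x - mu i) ^+ 2 / sigma ^+ 2 +
      s0 i ^- 2 * (x - mu i) ^+ 2 / n.+1%:R.
    by field; rewrite !gt_eqF.
  by rewrite lerD2l ler_pM2r ?invr_gt0// ler_pM2l ?invr_gt0.
have NV : 0 <= n.+1%:R^-1 :> R by rewrite invr_ge0.
have e1 : 0 <= 1 + e by rewrite addr_ge0// ltW.
have eV1 : 0 <= 1 + e^-1 by rewrite addr_ge0// invr_ge0 ltW.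
have := ler_wpM2r NV (le_trans tab young) => H; apply: (le_trans H).
have H1 := ler_wpM2l e1 a2N.
have H2 := ler_wpM2l eV1 (ler_wpM2r NV b2).
have -> : ((1 + e) * a ^+ 2 + (1 + e^-1) * (b + 1) ^+ 2) / n.+1%:R =
  (1 + e) * (a ^+ 2 / n.+1%:R) + (1 + e^-1) * ((b + 1) ^+ 2 / n.+1%:R) by ring.
rewrite addrA lerD//.
  apply: (le_trans H1); rewrite le_eqVlt; apply/orP; left; apply/eqP; ring.
apply: (le_trans H2); rewrite -b2E le_eqVlt; apply/orP; left; apply/eqP; ring.
Qed.

(** The bound holds from some round on uniformly in [j] and [x], because both will be chosen as
    functions of [n]; [D] dominates all the squares involved. *)
Lemma rate_le (e : R) : 0 < e -> \forall n \near \oo, forall j x, j != ord0 ->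
  mu j <= x <= mu ord0 ->
  rt n <= (1 + e) / (2 * sigma ^+ 2) *
    (p n ord0 * (x - mu ord0) ^+ 2 + p n j * (x - mu j) ^+ 2) + e.
Proof.
move=> e0.
pose D := \sum_i (mu ord0 - mu i) ^+ 2.
pose err n i := (1 + e) * (s0 i ^- 2 * D / n.+1%:R) +
  (1 + e^-1) * (2 * (mean_error n i + n.+1%:R^-1)).
have cvg_err i : err n i @[n --> \oo] --> 0.
  rewrite -[X in _ --> X](addr0 (0 : R)); apply: cvgD.
    rewrite -[X in _ --> X](mulr0 (1 + e)); apply: cvgM; first exact: cvg_cst.
    exact: cvg_cst_over_n.
  rewrite -[X in _ --> X](mulr0 (1 + e^-1)); apply: cvgM; first exact: cvg_cst.
  rewrite -[X in _ --> X](mulr0 2); apply: cvgM; first exact: cvg_cst.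
  rewrite -[X in _ --> X](addr0 (0 : R)); apply: cvgD.
    exact: cvg_mean_error.
  exact: cvg_harmonic.
have err_small : \forall n \near \oo, forall i, `|0 - err n i| <= e / 2.
  apply: filter_forall => i; move/cvgrPdist_le : (cvg_err i); apply.
  by rewrite divr_gt0.
have lnc : \forall n \near \oo, `|0 - 2 * ln c / n.+1%:R| <= e / 2.
  by move/cvgrPdist_le : (cvg_cst_over_n (2 * ln c)); apply; rewrite divr_gt0.
apply: filterS2 err_small lnc => n err_n ln_n j x j0 /andP[jx x0].
have DE : (mu ord0 - mu j) ^+ 2 <= D.
  by rewrite /D (bigD1 j)//= lerDl sumr_ge0// => i _; exact: sqr_ge0.
have Dj : (x - mu j) ^+ 2 <= D.
  apply: le_trans DE.
  by rewrite lerXn2r ?nnegrE ?subr_ge0 ?lerB// (le_trans jx).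
have D0 : (x - mu ord0) ^+ 2 <= D.
  apply: le_trans DE; rewrite -sqrrN opprB.
  by rewrite lerXn2r ?nnegrE ?subr_ge0 ?lerB// (le_trans jx).
have t0 := tail_le n e0 D0; have tj := tail_le n e0 Dj.
apply: (le_trans (rate_tail n x j0)).
have := err_n ord0; have := err_n j; move: ln_n t0 tj.
rewrite -/(err n ord0) -/(err n j) !sub0r !normrN.
set a := tail n ord0 x / _; set b := tail n j x / _.
set f := p n ord0 * _; set g := p n j * _.
move=> /ler_normlP[ln_n _] ta tb /ler_normlP[_ ej] /ler_normlP[_ e_0].
have -> : (1 + e) / (2 * sigma ^+ 2) * (f + g) =
    ((1 + e) / sigma ^+ 2 * f + (1 + e) / sigma ^+ 2 * g) / 2.
  by field; rewrite gt_eqF.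
move: (2 * ln c / _) ((1 + e) / _ * f) ((1 + e) / _ * g) ln_n ta tb ej e_0.
by move: (err n j) (err n ord0) a b => ? ? ? ? ? ? ?; lra.
Qed.

Lemma cvg_scaled_var (W : R) i : 0 < W -> p n i @[n --> \oo] --> W ->
  n.+1%:R * v n i @[n --> \oo] --> sigma ^+ 2 / W.
Proof.
move=> W0 pW; rewrite -invf_div.
have -> : (fun n => n.+1%:R * v n i) =
    (fun n => (s0 i ^- 2 / n.+1%:R + p n i / sigma ^+ 2)^-1).
  apply/funext => n; rewrite -[v n i]invrK post_var_inv /proportion.
  rewrite -[in LHS](invrK n.+1%:R) -invfM; congr (_^-1).
  by field; rewrite !gt_eqF.
apply: cvgV; first by rewrite gt_eqF// divr_gt0.
rewrite -[X in _ --> X]add0r; apply: cvgD; first exact: cvg_cst_over_n.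
by apply: cvgM => //; exact: cvg_cst.
Qed.

(** The squared error is [mean_error] times [n.+1%:R * v n i], and the second factor stays bounded
    when the arm has a positive limiting proportion. *)
Lemma cvg_post_mean (W : R) i : 0 < W -> p n i @[n --> \oo] --> W ->
  m n i @[n --> \oo] --> mu i.
Proof.
move=> W0 pW.
have H : mean_error n i * (n.+1%:R * v n i) @[n --> \oo] --> (0 : R).
  rewrite -[X in _ --> X](mul0r (sigma ^+ 2 / W)).
  by apply: cvgM; [exact: cvg_mean_error|exact: cvg_scaled_var].
apply/cvgrPdist_le => eps eps0.
have eps2 : 0 < eps ^+ 2 by rewrite exprn_gt0.
move/cvgrPdist_le : H => /(_ _ eps2); apply: filterS => n.
rewrite sub0r normrN /mean_error [_ * v n i]mulrC divfK; last first.
  by rewrite gt_eqF// mulr_gt0// post_var_gt0.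
rewrite ger0_norm ?sqr_ge0// -[X in X <= _ -> _]real_normK ?num_real//.
by rewrite distrC ler_pXn2r ?nnegrE// ltW.
Qed.

(** In the Chernoff bound the exponent for arm [j] is [n.+1%:R * E n j], and [E n j] tends to [- G]
    for every [j]; the number [K.+1] of terms is negligible on this scale. *)
Lemma rate_ge (W : arm -> R) (G e : R) : 0 < e -> (forall i, 0 < W i) ->
  (forall i, p n i @[n --> \oo] --> W i) ->
  (forall j, j != ord0 -> mu j <= mu ord0) ->
  (forall j, j != ord0 ->
    (mu j - mu ord0) ^+ 2 / (2 * sigma ^+ 2 * ((W j)^-1 + (W ord0)^-1)) = G) ->
  \forall n \near \oo, G - e <= rt n.
Proof.
move=> e0 W0 pW mu0 GE.
(* [n.+1%:R * l j] is the Chernoff parameter for comparing arm [j] with arm 1,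
   frozen at the limiting allocation. *)
pose l j := (mu ord0 - mu j) / (sigma ^+ 2 * ((W j)^-1 + (W ord0)^-1)).
have l0 j : 0 <= l j.
  have [->|j0] := eqVneq j ord0; first by rewrite /l subrr mul0r.
  have WV : 0 < (W j)^-1 + (W ord0)^-1 by rewrite addr_gt0 ?invr_gt0.
  by rewrite divr_ge0 ?subr_ge0 ?mu0// ltW// mulr_gt0.
pose E n j := l j * (m n j - m n ord0) +
  l j ^+ 2 * (n.+1%:R * v n j + n.+1%:R * v n ord0) / 2.
have cvgE j : j != ord0 -> E n j @[n --> \oo] --> - G.
  move=> j0.
  have -> : - G = l j * (mu j - mu ord0) +
      l j ^+ 2 * (sigma ^+ 2 / W j + sigma ^+ 2 / W ord0) / 2.
    rewrite -(GE j j0) /l; have := W0 j; have := W0 ord0 => W00 Wj0.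
    by field; rewrite !gt_eqF// addr_gt0.
  apply: cvgD; apply: cvgM; try exact: cvg_cst.
    by apply: cvgB; exact: cvg_post_mean (pW _).
  apply: cvgM; first exact: cvg_cst.
  by apply: cvgD; exact: cvg_scaled_var (pW _).
have e2 : 0 < e / 2 by rewrite divr_gt0.
have E_small : \forall n \near \oo, forall j, j != ord0 -> E n j <= - G + e / 2.
  apply: filter_forall => j; have [->|j0] := eqVneq j ord0.
    by apply: nearW => n.
  move/cvgrPdist_le : (cvgE j j0) => /(_ _ e2); apply: filterS => n.
  rewrite distrC => /ler_normlP[_ En] _.
  by rewrite -lerBlDl opprK addrC -[X in X + _]opprK addrC.
have lnK_small : \forall n \near \oo, `|0 - ln K.+1%:R / n.+1%:R| <= e / 2.
  by move/cvgrPdist_le : (cvg_cst_over_n (ln K.+1%:R)); apply.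
apply: filterS2 E_small lnK_small => n En ln_n.
have err : 1 - alphan n <= expR (ln K.+1%:R + n.+1%:R * (- G + e / 2)).
  rewrite alphaE.
  have l0n j : 0 <= n.+1%:R * l j by rewrite mulr_ge0.
  apply: (le_trans (one_sub_best_le (m n) ord0 (sd_gt0 n) l0n)).
  apply: (@le_trans _ _ (\sum_(j : arm | j != ord0)
      expR (n.+1%:R * (- G + e / 2)))).
    apply: ler_sum => j j0; rewrite ler_expR.
    apply: le_trans (ler_wpM2l (ltW (N_gt0 n)) (En j j0)).
    rewrite !sqr_sqrtr ?(ltW (post_var_gt0 _ _))// le_eqVlt.
    by apply/orP; left; apply/eqP; rewrite /E; field.
  rewrite sumr_const (_ : #|_| = K.+1); last first.
    by rewrite (cardC1 (ord0 : arm)) card_ord.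
  by rewrite expRD lnK ?posrE// [leRHS]mulr_natl.
have := err; rewrite -ler_ln ?posrE ?expR_gt0 ?error_gt0// expRK => lnerr.
rewrite /rate mulNr lerNr opprB mulrC ler_pdivrMr//.
apply: (le_trans lnerr).
move: ln_n; rewrite sub0r normrN => /(le_trans (ler_norm _)).
rewrite ler_pdivrMr// => ln_n.
apply: (le_trans (lerD ln_n (lexx _))).
by rewrite le_eqVlt; apply/orP; left; apply/eqP; field.
Qed.

End path.

(** * Limits of the rate *)

Lemma limn_esup_EFin_le (R : realType) (u : nat -> R) (G : R) :
  (forall e, 0 < e -> \forall n \near \oo, u n <= G + e) ->
  (limn_esup (fun n => (u n)%:E) <= G%:E)%E.
Proof.
move=> H; apply/lee_addgt0Pr => e e0; rewrite -EFinD.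
apply: (@le_trans _ _
    (ereal_sup ((fun n => (u n)%:E) @` [set n | u n <= G + e]))).
  (* The upper limit is an infimum of suprema over sets of the filter, and the set where
     [u n <= G + e] is one of them. *)
  by apply: ereal_inf_lbound; exists [set n | u n <= G + e] => //; exact: H.
by apply: ge_ereal_sup => _ [n /= un <-]; rewrite lee_fin.
Qed.

Section rates.
Context (R : realType) (K : nat) d (Omega : measurableType d)
  (P : probability Omega R) (mu m0 s0 : 'I_K.+2 -> R) (sigma : R)
  (Y : nat -> 'I_K.+2 -> {RV P >-> R}) (I : nat -> Omega -> 'I_K.+2)
  (w : Omega).
Hypotheses (sigma_gt0 : 0 < sigma) (s0_gt0 : forall i, 0 < s0 i)
  (mu_decr : forall i j : 'I_K.+2, (i < j)%N -> mu j < mu i).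
Hypothesis noise_small : forall i (e : R), 0 < e -> \forall n \near \oo,
  noise mu Y I n i w ^+ 2 <= e * n.+1%:R * (pulls I n i w).+1%:R.
Local Notation rt n := (rate sigma m0 s0 Y I n w).
Local Notation p n i := (proportion R I w n i).

Let s2_gt0 : 0 < 2 * sigma ^+ 2. Proof. by rewrite mulr_gt0// exprn_gt0. Qed.

Lemma rate_le_Gamma_star (e : R) : 0 < e ->
  \forall n \near \oo, rt n <= Gamma_star mu sigma + e.
Proof.
move=> e0; have [bs01 _] := beta_starP sigma_gt0 mu_decr.
have G0 := Gamma_ge0 sigma mu_decr bs01; rewrite -/(Gamma_star mu sigma) in G0.
(* Solves [(1 + e') * Gamma_star + e' = Gamma_star + e]. *)
pose e' := e / (Gamma_star mu sigma + 1).
have e'0 : 0 < e' by rewrite divr_gt0// ltr_wpDl.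
have := rate_le m0 sigma_gt0 s0_gt0 noise_small e'0.
apply: filterS => n rn.
have [j [x [j0 xj cost]]] := exists_cheap_arm_star sigma_gt0 mu_decr
  (proportion_ge0 R I w n) (proportion_lt1 R I w n ord0)
  (sum_proportion R I w n).
apply: (le_trans (rn j x j0 xj)).
have c0 : 0 <= (1 + e') / (2 * sigma ^+ 2).
  by rewrite divr_ge0 ?addr_ge0// ltW.
apply: (le_trans (lerD (ler_wpM2l c0 cost) (lexx _))).
rewrite le_eqVlt; apply/orP; left; apply/eqP; rewrite /e'; field.
by rewrite !gt_eqF// ltr_wpDl.
Qed.

Lemma rate_le_Gamma (b e : R) : 0 < b < 1 -> p n ord0 @[n --> \oo] --> b ->
  0 < e -> \forall n \near \oo, rt n <= Gamma mu sigma b + e.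
Proof.
move=> b01 pb e0.
have G0 := Gamma_ge0 sigma mu_decr b01; set G := Gamma mu sigma b in G0 *.
pose D := 2 * (mu ord0 - mu ord_max) ^+ 2 / (2 * sigma ^+ 2).
have D0 : 0 <= D by rewrite divr_ge0 ?(ltW s2_gt0)// mulr_ge0// sqr_ge0.
(* The total error is [e' * (G + (1 + e') * D + 1)], at most [e' * M] once [e' <= 1]. *)
pose M := G + 2 * D + 1.
have M0 : 0 < M by rewrite ltr_wpDl// addr_ge0// mulr_ge0.
pose e' := Num.min 1 (e / M).
have e'0 : 0 < e' by rewrite lt_min ltr01 divr_gt0.
have e'1 : e' <= 1 by rewrite ge_min lexx.
have e'M : e' * M <= e by rewrite -ler_pdivlMr// ge_min lexx orbT.
have := rate_le m0 sigma_gt0 s0_gt0 noise_small e'0.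
move/cvgrPdist_le : pb => /(_ _ e'0) pb.
apply: filterS2 pb => n pn rn.
have [j [x [j0 xj cost]]] := exists_cheap_arm sigma_gt0 mu_decr b01
  (proportion_ge0 R I w n) (sum_proportion R I w n).
apply: (le_trans (rn j x j0 xj)).
have c0 : 0 <= (1 + e') / (2 * sigma ^+ 2).
  by rewrite divr_ge0 ?addr_ge0// ltW.
have D'0 : 0 <= 2 * (mu ord0 - mu ord_max) ^+ 2 by rewrite mulr_ge0// sqr_ge0.
have cost' := le_trans cost (lerD (lexx _) (ler_wpM2r D'0 pn)).
apply: (le_trans (lerD (ler_wpM2l c0 cost') (lexx _))).
have -> : (1 + e') / (2 * sigma ^+ 2) * (2 * sigma ^+ 2 * G +
    e' * (2 * (mu ord0 - mu ord_max) ^+ 2)) + e' =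
  G + e' * (G + (1 + e') * D + 1) by rewrite /D; field; rewrite gt_eqF.
rewrite lerD2l (le_trans _ e'M)// ler_pM2l// /M lerD2r lerD2l.
by rewrite ler_wpM2r//; lra.
Qed.

(** The weights give all pairs (1, [j]) the same rate, so [rate_ge] applies with [G] equal to
    [Gamma mu sigma b], matching the upper bound. *)
Lemma rate_cvg_Gamma (b : R) : 0 < b < 1 ->
  (forall i, p n i @[n --> \oo] --> weights mu b i) ->
  rt n @[n --> \oo] --> Gamma mu sigma b.
Proof.
move=> b01 pw; have [w0 wpos _ _] := weightsP mu_decr b01.
have /andP[b0 _] := b01.
have wgt0 i : 0 < weights mu b i.
  by have [->|] := eqVneq i ord0; [rewrite w0|exact: wpos].
have mu0 j : j != ord0 -> mu j <= mu ord0.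
  by move=> j0; rewrite ltW// mu_decr// lt0n.
apply/cvgrPdist_le => e e0.
have pb : p n ord0 @[n --> \oo] --> b by rewrite -[X in _ --> X]w0; exact: pw.
have GE j : j != ord0 -> (mu j - mu ord0) ^+ 2 /
    (2 * sigma ^+ 2 * ((weights mu b j)^-1 + (weights mu b ord0)^-1)) =
    Gamma mu sigma b by move=> j0; rewrite w0 (Gamma_arm sigma mu_decr b01 j0).
have ge := rate_ge m0 sigma_gt0 s0_gt0 noise_small e0 wgt0 pw mu0 GE.
apply: filterS2 ge (rate_le_Gamma b01 pb e0) => n ge le.
by rewrite distrC ler_distl ge.
Qed.

End rates.

Theorem theorem2 (R : realType) (K : nat) (d : measure_display)
    (Omega : measurableType d) (P : probability Omega R)
    (mu m0 s0 : 'I_K.+2 -> R) (sigma : R)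
    (Y : nat -> 'I_K.+2 -> {RV P >-> R})
    (sigma_gt0 : 0 < sigma)
    (mu_decr : forall i j : 'I_K.+2, (i < j)%N -> mu j < mu i)
    (s0_gt0 : forall i, 0 < s0 i)
    (HY : gaussian_rewards mu sigma Y) :
  ((forall I, sampling_rule Y I ->
      (forall i, proportions_cvg P I i (weights_star mu sigma i)) ->
      {ae P, forall w, rate sigma m0 s0 Y I n w @[n --> \oo]
                         --> Gamma_star mu sigma}) /\
   (forall I, sampling_rule Y I ->
      {ae P, forall w, (limn_esup (fun n => (rate sigma m0 s0 Y I n w)%:E)
                         <= (Gamma_star mu sigma)%:E)%E})) /\
  (forall beta : R, 0 < beta < 1 ->
    (forall I, sampling_rule Y I ->
       (forall i, proportions_cvg P I i (weights mu beta i)) ->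
       {ae P, forall w, rate sigma m0 s0 Y I n w @[n --> \oo]
                          --> Gamma mu sigma beta}) /\
    (forall I, sampling_rule Y I ->
       proportions_cvg P I ord0 beta ->
       {ae P, forall w, (limn_esup (fun n => (rate sigma m0 s0 Y I n w)%:E)
                          <= (Gamma mu sigma beta)%:E)%E})).
Proof.
(* One null set serves all the arms, as they are finitely many; off it, the argument is
   deterministic. *)
have noise I : sampling_rule Y I -> {ae P, forall w i (e : R), 0 < e ->
    \forall n \near \oo,
    noise mu Y I n i w ^+ 2 <= e * n.+1%:R * (pulls I n i w).+1%:R}.
  by move=> HI; apply: filter_forall => i; exact: ae_noise_small HY HI i.
have limit I b : 0 < b < 1 -> sampling_rule Y I ->
    (forall i, proportions_cvg P I i (weights mu b i)) ->
    {ae P, forall w, rate sigma m0 s0 Y I n w @[n --> \oo]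
                       --> Gamma mu sigma b}.
  move=> b01 HI /filter_forall; apply: filterS2 (noise I HI) => w small pw.
  exact: rate_cvg_Gamma.
split; [split|move=> b b01; split].
- by move=> I; apply: limit; have [] := beta_starP sigma_gt0 mu_decr.
- move=> I HI; apply: filterS (noise I HI) => w small.
  by apply: limn_esup_EFin_le => e; exact: rate_le_Gamma_star.
- by move=> I; exact: limit.
- move=> I HI pb; apply: filterS2 (noise I HI) pb => w small pb.
  by apply: limn_esup_EFin_le => e; exact: rate_le_Gamma.
Qed.
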